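(* Let $p$ be a prime greater than $3$ and let $n$ be a positive integer not divisible by $p$. If $n\equiv 0$ or $2\pmod 3$, then $n$ is a sum of $k$ squares not divisible by $p$ for some positive integer $k\le 4$.
   Context: For a prime $p$, an integer $n$ is a sum of $k$ squares not divisible by $p$ if there are integers $x_1,\dots,x_k$ with $n=x_1^2+\cdots+x_k^2$ and $\gcd(p,x_1x_2\cdots x_k)=1$. *)

(* Defs.v *)
From HB Require Import structures.
From mathcomp Require Import all_boot all_order all_algebra.
Set Implicit Arguments.
Unset Strict Implicit.
Unset Printing Implicit Defensive.
Import Order.TTheory GRing.Theory Num.Theory.
Local Open Scope ring_scope.

Definition sum_of_squares_ndiv (p k : nat) (n : int) : Prop :=
  exists x : 'I_k -> int,
    n = \sum_(i < k) x i ^+ 2 /\ coprimez p%:Z (\prod_(i < k) x i).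

(* Main.v *)
(**
By Lagrange's theorem n = a^2 + b^2 + c^2 + d^2. If v has three entries 1 or -1 and one
entry 0, the reflection in v preserves the sum of squares and maps x to an integral vector
as soon as v.x is divisible by 3; for n = 0 or 2 mod 3 enough such v exist. The aim is to
make every nonzero coordinate prime to p. If a triple has one coordinate prime to p, a
single reflection turns all three into units modulo p. If it has two, x and y, with z a
nonzero multiple of p, the reflection can only fail when x = -y, x = 2y or y = 2x modulo
p; then the image has the same shape, and iterating acts on (x + y, z), resp. (x - 2y, z),
by a map that lowers the 3-adic valuation, until the position of the coordinate divisible
by 3 changes and another reflection becomes available.

For p = 5 this works only if x^2 = y^2 mod 5, since x = 2y gives an isotropic triple, and
the vectors c(2, 2, 1, 0) mod 5 need another argument. In the difficult case ([type_I]
below) a finite search shows that a vector from which no reflections lead to success is,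
modulo 81, on one of the lines spanned by (3, 3, 4, 5), (-3, -3, 1, 5) and (6, 6, -2, 5).
Rational isometries fixing such a line and expanding its complement 3-adically then force
the vector to lie on the line exactly. So n is 59, 44 or 101 times a square, and
59 = 49 + 9 + 1, 44 = 36 + 4 + 4, 101 = 81 + 16 + 4.
*)
From Stdlib Require Import ZArith Znumtheory Lia Classical_Prop.
Require Import Defs.
From HB Require Import structures.
From mathcomp Require Import all_boot all_order all_algebra.
Set Implicit Arguments.
Unset Strict Implicit.
Unset Printing Implicit Defensive.

Local Open Scope Z_scope.

Ltac Zify.zify_post_hook ::= Z.to_euclidean_division_equations.

(** * Reflections and sums of three squares *)

Definition three_units (p n : Z) : Prop :=
  exists x y z, n = x ^ 2 + y ^ 2 + z ^ 2 /\ ~ (p | x) /\ ~ (p | y) /\ ~ (p | z).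

Lemma sqr_mod3 x : [\/ x mod 3 = 0 /\ x ^ 2 mod 3 = 0,
  x mod 3 = 1 /\ x ^ 2 mod 3 = 1 | x mod 3 = 2 /\ x ^ 2 mod 3 = 1].
Proof.
have h : x ^ 2 mod 3 = ((x mod 3) ^ 2) mod 3 by rewrite Z.pow_2_r Zmult_mod -Z.pow_2_r.
have [e|[e|e]] : x mod 3 = 0 \/ x mod 3 = 1 \/ x mod 3 = 2 by lia.
- by constructor 1; rewrite h e.
- by constructor 2; rewrite h e.
- by constructor 3; rewrite h e.
Qed.

Lemma sqr_mod3_0 w : w mod 3 = 0 -> w ^ 2 mod 3 = 0.
Proof. by case: (sqr_mod3 w) => [[h1 h2]|[h1 h2]|[h1 h2]] h //; rewrite h in h1. Qed.

Lemma sqr_mod3_1 w : w mod 3 <> 0 -> w ^ 2 mod 3 = 1.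
Proof. by case: (sqr_mod3 w) => [[h1 h2]|[h1 h2]|[h1 h2]] h. Qed.

(** Reflection in [(1, 1, 1)], a vector of norm 3 whose scalar product with [(x, y, z)] is [3 t]. *)
Lemma reflect3 x y z t : x + y + z = 3 * t ->
  (x - 2 * t) ^ 2 + (y - 2 * t) ^ 2 + (z - 2 * t) ^ 2 = x ^ 2 + y ^ 2 + z ^ 2.
Proof. move=> h; have -> : z = 3 * t - x - y by lia. ring. Qed.

Lemma divide_comb i j a b c p : (p | a) -> (p | b) -> c = i * a + j * b -> (p | c).
Proof. by move=> ha hb ->; apply: Z.divide_add_r; apply: Z.divide_mul_r. Qed.

Lemma prime_cancel q p x : Znumtheory.prime p -> 0 < q < p -> (p | q * x) -> (p | x).
Proof.
move=> pp hq /(prime_mult p pp)[/Z.divide_pos_le h|//]; lia.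
Qed.

(** Modulo [p] the image satisfies [3 x' = x] and [3 y' = 3 z' = -2 x], and [p] is prime to 6. *)
Lemma one_unit_reflect p x y z : Znumtheory.prime p -> 3 < p ->
  ~ (p | x) -> (p | y) -> (p | z) -> (x + y + z) mod 3 = 0 ->
  three_units p (x ^ 2 + y ^ 2 + z ^ 2).
Proof.
move=> pp p3 ux py pz; set t := (x + y + z) / 3 => hs.
have ht : x + y + z = 3 * t by rewrite /t; lia.
have pyz : (p | y + z) by apply: Z.divide_add_r.
exists (x - 2 * t), (y - 2 * t), (z - 2 * t); split; first by rewrite reflect3.
split=> [h|]; [|split=> h]; apply: ux.
- apply: (divide_comb (i := 3) (j := 2) h pyz); lia.
- apply: (@prime_cancel 2) => //; first lia.
  apply: (divide_comb (i := -1) (j := -2) (b := z) (divide_comb (i := 3) (j := -1) h py erefl)) => //; lia.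
- apply: (@prime_cancel 2) => //; first lia.
  apply: (divide_comb (i := -1) (j := -2) (b := y) (divide_comb (i := 3) (j := -1) h pz erefl)) => //; lia.
Qed.

(** Since the sum of squares is not 1 modulo 3, zero, two or three coordinates are prime to 3; each
    time some signs of [y] and [z] make the sum divisible by 3. *)
Lemma one_unit p x y z : Znumtheory.prime p -> 3 < p ->
  ~ (p | x) -> (p | y) -> (p | z) -> (x ^ 2 + y ^ 2 + z ^ 2) mod 3 <> 1 ->
  three_units p (x ^ 2 + y ^ 2 + z ^ 2).
Proof.
move=> pp p3 ux py pz hn.
have e w : (- w) ^ 2 = w ^ 2 by ring.
have py' : (p | - y) by apply/Z.divide_opp_r.
have pz' : (p | - z) by apply/Z.divide_opp_r.
have [h|[h|[h|h]]] : (x + y + z) mod 3 = 0 \/ (x + - y + z) mod 3 = 0 \/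
    (x + y + - z) mod 3 = 0 \/ (x + - y + - z) mod 3 = 0.
  have := sqr_mod3 x; have := sqr_mod3 y; have := sqr_mod3 z.
  clear -hn; move: (x ^ 2) (y ^ 2) (z ^ 2) hn => a b c hn.
  by move=> [][? ?] [][? ?] [][? ?]; lia.
- exact: one_unit_reflect.
- by rewrite -(e y); apply: one_unit_reflect.
- by rewrite -(e z); apply: one_unit_reflect.
- by rewrite -(e y) -(e z); apply: one_unit_reflect.
Qed.

(* After a reflection, [3 x' = x - 2 y - 2 z] and cyclically. *)
Lemma two_units_reflect p x y z : Znumtheory.prime p -> 3 < p -> (p | z) ->
  (x + y + z) mod 3 = 0 ->
  ~ (p | x - 2 * y) -> ~ (p | y - 2 * x) -> ~ (p | x + y) ->
  three_units p (x ^ 2 + y ^ 2 + z ^ 2).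
Proof.
move=> pp p3 pz; set t := (x + y + z) / 3 => hs h1 h2 h3.
have ht : x + y + z = 3 * t by rewrite /t; lia.
exists (x - 2 * t), (y - 2 * t), (z - 2 * t); split; first by rewrite reflect3.
split=> [h|]; [apply: h1|split=> h; [apply: h2|apply: h3]].
- apply: (divide_comb (i := 3) (j := 2) h pz); lia.
- apply: (divide_comb (i := 3) (j := 2) h pz); lia.
- apply: (@prime_cancel 2) => //; first lia.
  apply: (divide_comb (i := -3) (j := 1) h pz); lia.
Qed.

(** Reflections are available for both [y] and [- y]. If both fail, then [p] divides [5 x] or [5 y],
    which is impossible when [p] does not divide 5. Under the other hypothesis [x = y] or [x = - y]
    modulo [p], which rules out the failure for [y], resp. [- y]. *)
Lemma two_units_free_sign p x y z : Znumtheory.prime p -> 3 < p ->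
  ~ (p | x) -> ~ (p | y) -> (p | z) -> ~ (p | 5) \/ (p | x ^ 2 - y ^ 2) ->
  (x + y + z) mod 3 = 0 -> (x - y + z) mod 3 = 0 ->
  three_units p (x ^ 2 + y ^ 2 + z ^ 2).
Proof.
move=> pp p3 ux uy pz hp hs hs'.
have c2 w : (p | 2 * w) -> (p | w) by apply: prime_cancel => //; lia.
have c4 w : (p | 4 * w) -> (p | w).
  rewrite (_ : 4 * w = 2 * (2 * w)); last lia.
  by move/c2/c2.
pose bad u v := [\/ (p | u - 2 * v), (p | v - 2 * u) | (p | u + v)].
have refl y' : (x + y' + z) mod 3 = 0 -> ~ bad x y' ->
    three_units p (x ^ 2 + y' ^ 2 + z ^ 2).
  move=> h nb; apply: two_units_reflect => // h'; apply: nb.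
  - by constructor 1.
  - by constructor 2.
  - by constructor 3.
case: (classic (bad x y)) => [b1|]; last exact: refl.
case: (classic (bad x (- y))) => [b2|]; last first.
  have -> : y ^ 2 = (- y) ^ 2 by ring.
  by apply: refl; rewrite Z.add_opp_r.
exfalso.
have hp' : (p | 5 * x) \/ (p | 5 * y) -> (p | x - y) \/ (p | x + y).
  case: hp => [np5|hp _]; last by apply: prime_mult => //; move: hp; congr Z.divide; ring.
  by case=> /(prime_mult p pp)[].
have no1 : (p | x - y) -> (p | x + y) -> False.
  by move=> h1 h2; apply: ux; apply: c2; apply: (divide_comb (i := 1) (j := 1) h1 h2); lia.
have no2 : bad x y -> (p | x - y) -> False.
  move=> [] h1 h2.
  - by apply: uy; apply: (divide_comb (i := -1) (j := 1) h1 h2); lia.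
  - by apply: ux; apply: (divide_comb (i := -1) (j := -1) h1 h2); lia.
  - exact: no1.
have no3 : bad x (- y) -> (p | x + y) -> False.
  move=> [] h1 h2.
  - by apply: uy; apply: (divide_comb (i := 1) (j := -1) h1 h2); lia.
  - by apply: ux; apply: (divide_comb (i := -1) (j := -1) h1 h2); lia.
  - by apply: no1 => //; move: h1; congr Z.divide; lia.
have : (p | 5 * x) \/ (p | 5 * y).
  case: b1 => h1; case: b2 => h2.
  - right; apply: c4; apply: (divide_comb (i := -5) (j := 5) h1 h2); lia.
  - left; apply: (divide_comb (i := 1) (j := -2) h1 h2); lia.
  - by right; apply: (divide_comb (i := -5) (j := 5) h1 h2); lia.
  - left; apply: (divide_comb (i := -2) (j := 1) h1 h2); lia.
  - left; apply: c4; apply: (divide_comb (i := -5) (j := -5) h1 h2); lia.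
  - left; apply: (divide_comb (i := -5) (j := -5) h1 h2); lia.
  - right; apply: (divide_comb (i := -5) (j := 5) h1 h2); lia.
  - left; apply: (divide_comb (i := -5) (j := -5) h1 h2); lia.
  - by left; apply: c2; apply: (divide_comb (i := 5) (j := 5) h1 h2); lia.
case/hp'; [exact: no2 | exact: no3].
Qed.

(** * 3-adic descent for triples with two units *)

Lemma divide_triple_half K w : 0 < K -> (K | w) -> (3 * K | 2 * w) -> (3 * K | w).
Proof.
move=> K0 [j hj] [q hq].
have e : 2 * j = 3 * q by apply: (Z.mul_reg_r _ _ K); lia.
have [m hm] : exists m, j = 3 * m by exists (j / 3); lia.
by exists m; rewrite hj hm; ring.
Qed.

Lemma divide_triple K w v : 0 < K -> (K | w) -> 3 * w = v -> (3 * K | v).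
Proof. by move=> K0 [j ->] <-; exists j; ring. Qed.

Lemma pow3_succ k : 3 ^ Z.of_nat k.+1 = 3 * 3 ^ Z.of_nat k.
Proof. by rewrite Nat2Z.inj_succ Z.pow_succ_r //; lia. Qed.

Lemma pow3_gt0 k : 0 < 3 ^ Z.of_nat k.
Proof. by apply: Z.pow_pos_nonneg; lia. Qed.

Lemma not_divide_pow3 z : z <> 0 -> exists k : nat, ~ (3 ^ Z.of_nat k | z).
Proof.
move=> z0; exists (Z.abs_nat z) => /Z.divide_abs_r h.
have := Z.divide_pos_le _ _ _ h.
have := Z.pow_gt_lin_r 3 (Z.of_nat (Z.abs_nat z)).
rewrite Zabs2Nat.id_abs; lia.
Qed.

Lemma divide_pow3_sign K u z : 0 < K -> (K | u) -> (K | z) ->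
  ~ ((3 * K | u) /\ (3 * K | z)) -> ~ (3 * K | u + z) \/ ~ (3 * K | u + - z).
Proof.
move=> K0 hu hz h.
have [h1|] := classic (3 * K | u + z); last by left.
have [h2|] := classic (3 * K | u + - z); last by right.
case: h; split; apply: divide_triple_half => //.
- by apply: (divide_comb (i := 1) (j := 1) h1 h2); lia.
- by apply: (divide_comb (i := 1) (j := -1) h1 h2); lia.
Qed.

(** Induction on a bound [k] for the 3-adic valuation of the pair [(x + y, z)]. With the sign of [z]
    from [divide_pow3_sign], the identity [3 z' = 3 z - 2 (x + y + z)] shows that the reflected [z']
    has a smaller bound. *)
Lemma two_units_opposite p k x y z : Znumtheory.prime p -> 3 < p ->
  ~ (p | x) -> (p | x + y) -> (p | z) ->
  (x + y) mod 3 = 0 -> z mod 3 = 0 -> x mod 3 <> 0 ->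
  ~ ((3 ^ Z.of_nat k | x + y) /\ (3 ^ Z.of_nat k | z)) ->
  three_units p (x ^ 2 + y ^ 2 + z ^ 2).
Proof.
move=> pp p3; elim: k x y z => [|k IH] x y z ux pxy pz hxy hz hx hk.
  by case: hk; split; apply: Z.divide_1_l.
have [[Kxy Kz]|] := classic ((3 ^ Z.of_nat k | x + y) /\ (3 ^ Z.of_nat k | z)); last exact: IH.
have K0 := pow3_gt0 k; rewrite pow3_succ in hk; set K := 3 ^ Z.of_nat k in IH hk Kxy Kz K0.
wlog hs : z pz hz hk Kz / ~ (3 * K | x + y + z).
  move=> W; have [h|h] := divide_pow3_sign K0 Kxy Kz hk; first exact: W.
  rewrite (_ : z ^ 2 = (- z) ^ 2); last by ring.
  apply: W => //; [exact/Z.divide_opp_r|by clear -hz; lia| |exact/Z.divide_opp_r].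
  by case=> h1 /Z.divide_opp_r h2; apply: hk.
set t := (x + y + z) / 3; have ht : x + y + z = 3 * t by rewrite /t; lia.
have pt : (p | t).
  apply: (@prime_cancel 3) => //.
  by rewrite -ht; apply: Z.divide_add_r.
rewrite -(reflect3 ht).
have ux' : ~ (p | x - 2 * t).
  by move=> h; apply: ux; apply: (divide_comb (i := 1) (j := 2) h pt); lia.
have uy' : ~ (p | y - 2 * t).
  by move=> h; apply: ux; apply: (divide_comb (i := -1) (j := 1) (divide_comb (i := 1) (j := 2) h pt erefl) pxy); lia.
have pz' : (p | z - 2 * t).
  by apply: (divide_comb (i := 1) (j := -2) pz pt); lia.
have pxy' : (p | (x - 2 * t) + (y - 2 * t)).
  by apply: (divide_comb (i := 1) (j := -4) pxy pt); lia.
have pxy2 : (p | (x - 2 * t) ^ 2 - (y - 2 * t) ^ 2).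
  have -> : (x - 2 * t) ^ 2 - (y - 2 * t) ^ 2 = ((x - 2 * t) - (y - 2 * t)) * ((x - 2 * t) + (y - 2 * t)) by ring.
  exact: Z.divide_mul_r.
have [t3|t3] := Z.eq_dec (t mod 3) 0.
  apply: IH => //; try lia.
  case=> _ h; apply: hs.
  have h3 := divide_triple K0 h erefl.
  have h3z := divide_triple K0 Kz erefl.
  apply: divide_triple_half => //.
    have -> : x + y + z = 1 * (x + y) + 1 * z by lia.
    exact: (divide_comb Kxy Kz erefl).
  apply: (divide_comb (i := -1) (j := 1) h3 h3z); lia.
(* As [t] is prime to 3, the coordinate divisible by 3 is no longer the third but one of the first
   two, whose sign is now free. *)
have [h|h] : (y - 2 * t) mod 3 = 0 \/ (x - 2 * t) mod 3 = 0.
  by clearbody t; clear -hxy hx t3; lia.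
- apply: two_units_free_sign => //; [by right|lia|lia].
- rewrite (Z.add_comm ((x - 2 * t) ^ 2)).
  apply: two_units_free_sign => //; [right|lia|lia].
  by apply/Z.divide_opp_r; move: pxy2; congr Z.divide; ring.
Qed.

(* Reflecting and reversing maps [(u, z)], with [u = x - 2 y], to
   [((2 u + 5 z) / 3, (u - 2 z) / 3)], which lowers the 3-adic valuation for one of the two
   signs of [z]. *)
Lemma double_descent p k x y z : Znumtheory.prime p -> 3 < p ->
  (p | x - 2 * y) -> (p | z) ->
  (x + y) mod 3 = 0 -> z mod 3 = 0 -> x mod 3 <> 0 ->
  ~ ((3 ^ Z.of_nat k | x - 2 * y) /\ (3 ^ Z.of_nat k | z)) ->
  exists X Y Z, [/\ x ^ 2 + y ^ 2 + z ^ 2 = X ^ 2 + Y ^ 2 + Z ^ 2,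
    (p | X - 2 * Y) /\ (p | Z), (p | Y - y) \/ (p | Y + y),
    (X + Y + Z) mod 3 = 0 & Z mod 3 <> 0 /\ (X mod 3 = 0 \/ Y mod 3 = 0)].
Proof.
move=> pp p3; elim: k x y z => [|k IH] x y z pxy pz hxy hz hx hk.
  by case: hk; split; apply: Z.divide_1_l.
have [[Kxy Kz]|] := classic ((3 ^ Z.of_nat k | x - 2 * y) /\ (3 ^ Z.of_nat k | z)); last exact: IH.
have K0 := pow3_gt0 k; rewrite pow3_succ in hk; set K := 3 ^ Z.of_nat k in IH hk Kxy Kz K0.
wlog hs : z pz hz hk Kz / ~ (3 * K | x - 2 * y + z).
  move=> W; have [h|h] := divide_pow3_sign K0 Kxy Kz hk; first exact: W.
  rewrite (_ : z ^ 2 = (- z) ^ 2); last by ring.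
  apply: W => //; [exact/Z.divide_opp_r|by clear -hz; lia| |exact/Z.divide_opp_r].
  by case=> h1 /Z.divide_opp_r h2; apply: hk.
set t := (x + y + z) / 3; have ht : x + y + z = 3 * t by rewrite /t; lia.
(* Modulo [p] the reflected vector is [(0, - y, - 2 y)]; reversing it restores the shape [X = 2 Y],
   [Z = 0]. *)
have [X hX] : exists X, X = z - 2 * t by exists (z - 2 * t).
have [Y hY] : exists Y, Y = y - 2 * t by exists (y - 2 * t).
have [Z hZ] : exists Z, Z = x - 2 * t by exists (x - 2 * t).
clearbody t K.
have e : x ^ 2 + y ^ 2 + z ^ 2 = X ^ 2 + Y ^ 2 + Z ^ 2 by rewrite -(reflect3 ht) hX hY hZ; ring.
have c3 w : (p | 3 * w) -> (p | w) by apply: prime_cancel.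
have pXY : (p | X - 2 * Y).
  apply: c3; apply: (divide_comb (i := 2) (j := 5) pxy pz); clear -hX hY ht; lia.
have pZ : (p | Z).
  apply: c3; apply: (divide_comb (i := 1) (j := -2) pxy pz); clear -hZ ht; lia.
(* Each reflection negates the middle coordinate modulo [p], whence the two signs in the
   conclusion. *)
have pY : (p | Y + y).
  apply: c3; apply: (divide_comb (i := -2) (j := -2) pxy pz); clear -hY ht; lia.
rewrite e.
have m1 : (X + Y + Z) mod 3 = 0 by clear -hX hY hZ ht; lia.
have [Z3|Z3] := Z.eq_dec (Z mod 3) 0; last first.
  exists X, Y, Z; split=> //; first by right.
  by split=> //; clear -hX hY hZ ht hxy hz hx Z3; lia.
have [||||X' [Y' [Z' [e' h1 h2 h3 h4]]]] := IH X Y Z pXY pZ.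
- by clear -m1 Z3; lia.
- by [].
- by clear -hX hY hZ ht hxy hz hx Z3; lia.
- case=> _ h; apply: hs.
  have h3 := divide_triple K0 h erefl.
  have h3z := divide_triple K0 Kz erefl.
  apply: (divide_comb (i := 1) (j := 1) h3 h3z); clear -hZ ht; lia.
exists X', Y', Z'; split=> //.
case: h2 => h2.
- by right; apply: (divide_comb (i := 1) (j := 1) h2 pY); lia.
- by left; apply: (divide_comb (i := 1) (j := -1) h2 pY); lia.
Qed.

(** Either exactly two coordinates are prime to 3 or none is. With three of them prime to 3, a
    single choice of relative signs would admit a reflection, which is too rigid. *)
Definition pattern3 (x y z : Z) : Prop :=
  (x ^ 2 + y ^ 2 + z ^ 2) mod 3 = 2 \/ [/\ x mod 3 = 0, y mod 3 = 0 & z mod 3 = 0].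

(** If 3 divides [x] or [y], the sign of that coordinate is free. If 3 divides only [z], normalise
    to [x + y = 0] modulo 3; the three possible failures of the reflection go to
    [two_units_opposite] and, for [x] and [y] in either order, to [double_descent]. *)
Lemma two_units p x y z : Znumtheory.prime p -> 3 < p ->
  ~ (p | x) -> ~ (p | y) -> (p | z) -> z <> 0 -> ~ (p | 5) \/ (p | x ^ 2 - y ^ 2) ->
  pattern3 x y z -> three_units p (x ^ 2 + y ^ 2 + z ^ 2).
Proof.
move=> pp p3 ux uy pz z0 hp; rewrite /pattern3.
have e w : (- w) ^ 2 = w ^ 2 by ring.
have oz : (p | - z) by apply/Z.divide_opp_r.
have oy : ~ (p | - y) by move/Z.divide_opp_r.
have hp' : ~ (p | 5) \/ (p | y ^ 2 - x ^ 2).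
  case: hp => hp; [by left|right].
  by apply/Z.divide_opp_r; move: hp; congr Z.divide; ring.
case=> [hn|[x3 y3 z3]]; last first.
  by apply: two_units_free_sign => //; clear -x3 y3 z3; lia.
have cases : [\/ y mod 3 = 0 /\ ((x + z) mod 3 = 0 \/ (x + - z) mod 3 = 0),
   x mod 3 = 0 /\ ((y + z) mod 3 = 0 \/ (y + - z) mod 3 = 0) |
   [/\ z mod 3 = 0, x mod 3 <> 0 & (x + y) mod 3 = 0 \/ (x + - y) mod 3 = 0]].
  move: (sqr_mod3 x) (sqr_mod3 y) (sqr_mod3 z).
  clear -hn; move: (x ^ 2) (y ^ 2) (z ^ 2) hn => a b c hn.
  move=> [][? ?] [][? ?] [][? ?]; try lia;
   try (by constructor 1; split=> //; lia); try (by constructor 2; split=> //; lia);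
   by constructor 3; split=> //; lia.
case: cases => [[y3 [h|h]]|[x3 [h|h]]|[z3 x3 h]].
- by apply: two_units_free_sign => //; clear -h y3; lia.
- by rewrite -(e z); apply: two_units_free_sign => //; clear -h y3; lia.
- by rewrite (Z.add_comm (x ^ 2)); apply: two_units_free_sign => //; clear -h x3; lia.
- rewrite (Z.add_comm (x ^ 2)) -(e z).
  by apply: two_units_free_sign => //; clear -h x3; lia.
wlog {h} hxy : y uy oy hp hp' hn / (x + y) mod 3 = 0.
  move=> W; case: h => h; first exact: W.
  by rewrite -(e y); apply: W => //; rewrite ?e ?Z.opp_involutive.
have [bo|bo] := classic (p | x + y).
  have [k hk] := not_divide_pow3 z0.
  by apply: (two_units_opposite (k := k)) => // -[].
have [k hk] := not_divide_pow3 z0.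
have finish X Y : (p | X - 2 * Y) -> ~ (p | Y) -> ~ (p | X) -> (X + Y) mod 3 = 0 -> X mod 3 <> 0 ->
    ~ (p | 5) \/ (p | X ^ 2 - Y ^ 2) -> three_units p (X ^ 2 + Y ^ 2 + z ^ 2).
  move=> pXY uY uX hXY X3 hpXY.
  (* [X = 2 Y] and [X ^ 2 = Y ^ 2] modulo [p] would give [3 Y ^ 2 = 0]. *)
  have np5 : ~ (p | 5).
    case: hpXY => // h _; apply: uY; apply: (@prime_cancel 3) => //.
    have [] := prime_mult p pp Y (3 * Y); last by [].
      apply: (divide_comb (i := - (X + 2 * Y)) (j := 1) pXY h); ring.
    by move=> hY; apply: Z.divide_mul_r.
  have [||||X' [Y' [Z' [-> [h1 h2] h3 h4 [h5 h6]]]]] := @double_descent p k X Y z pp p3 pXY pz => //.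
    by case.
  have uY' : ~ (p | Y').
    move=> hY'; apply: uY; case: h3 => h3.
    + by apply: (divide_comb (i := 1) (j := -1) hY' h3); lia.
    + by apply: (divide_comb (i := -1) (j := 1) hY' h3); lia.
  have uX' : ~ (p | X').
    move=> hX'; apply: uY'; apply: (@prime_cancel 2) => //; first lia.
    by apply: (divide_comb (i := 1) (j := -1) hX' h1); lia.
  case: h6 => h6.
  - rewrite (Z.add_comm (X' ^ 2)).
    by apply: two_units_free_sign => //; [by left|clear -h4 h6; lia|clear -h4 h6; lia].
  - by apply: two_units_free_sign => //; [by left|clear -h4 h6; lia].
have [b1|b1] := classic (p | x - 2 * y); first exact: finish.
have [b2|b2] := classic (p | y - 2 * x).
  rewrite (Z.add_comm (x ^ 2)); apply: finish => //; clear -hxy x3; lia.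
by apply: two_units_reflect => //; clear -hxy z3; lia.
Qed.

(** * Increasing the number of coordinates prime to p *)

(** Zero coordinates are allowed; dropping them at the end produces the variable number of
    squares. *)
Definition four_squares_ndiv (p n : Z) : Prop :=
  exists a b c d, [/\ n = a ^ 2 + b ^ 2 + c ^ 2 + d ^ 2,
    a = 0 \/ ~ (p | a), b = 0 \/ ~ (p | b), c = 0 \/ ~ (p | c) & d = 0 \/ ~ (p | d)].

(** Zero, two or three of the coordinates are prime to 3, so dropping a suitable one other than [x]
    leaves none or two. All triples contain [x], so a prescribed coordinate can be kept. *)
Lemma pattern3_exists x y z w : (x ^ 2 + y ^ 2 + z ^ 2 + w ^ 2) mod 3 <> 1 ->
  [\/ pattern3 x y z, pattern3 x y w | pattern3 x z w].
Proof.
rewrite /pattern3.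
move: (sqr_mod3 x) (sqr_mod3 y) (sqr_mod3 z) (sqr_mod3 w).
move: (x ^ 2) (y ^ 2) (z ^ 2) (w ^ 2) => a b c d.
move=> [][? ?] [][? ?] [][? ?] [][? ?] ?; try (by exfalso; lia);
  try (by constructor 1; right); try (by constructor 1; left; lia);
  try (by constructor 2; left; lia); by constructor 3; left; lia.
Qed.

Lemma sqr_mod5 x : [\/ x mod 5 = 0 /\ x ^ 2 mod 5 = 0,
  (x mod 5 = 1 \/ x mod 5 = 4) /\ x ^ 2 mod 5 = 1 |
  (x mod 5 = 2 \/ x mod 5 = 3) /\ x ^ 2 mod 5 = 4].
Proof.
have h : x ^ 2 mod 5 = ((x mod 5) ^ 2) mod 5 by rewrite Z.pow_2_r Zmult_mod -Z.pow_2_r.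
have [e|[e|[e|[e|e]]]] : x mod 5 = 0 \/ x mod 5 = 1 \/ x mod 5 = 2 \/ x mod 5 = 3 \/ x mod 5 = 4 by lia.
- by constructor 1; rewrite h e.
- by constructor 2; rewrite h e; split=> //; left.
- by constructor 3; rewrite h e; split=> //; left.
- by constructor 3; rewrite h e; split=> //; right.
- by constructor 2; rewrite h e; split=> //; right.
Qed.

Lemma divide5 x : (5 | x) <-> x mod 5 = 0.
Proof. by rewrite Z.mod_divide. Qed.

Lemma prime_gt3_divide5 p : Znumtheory.prime p -> 3 < p -> (p | 5) -> p = 5.
Proof.
move=> pp p3 h; have hle := Z.divide_pos_le _ _ _ h.
have [e|//] : p = 4 \/ p = 5 by lia.
by case: h => q; lia.
Qed.

(** Squares of units modulo 5 are 1 or -1, and opposite ones sum to 0. *)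
Lemma equal_squares_mod5 p e g : Znumtheory.prime p -> 3 < p ->
  ~ (p | e) -> ~ (p | g) -> ~ (p | e ^ 2 + g ^ 2) -> ~ (p | 5) \/ (p | e ^ 2 - g ^ 2).
Proof.
move=> pp p3; have [h|] := classic (p | 5); last by left.
rewrite (prime_gt3_divide5 pp p3 h) !divide5 => ue ug ueg; right.
have := sqr_mod5 e; have := sqr_mod5 g; move: (e ^ 2) (g ^ 2) ueg => a b ueg.
by move=> [][h1 h2] [][h3 h4] //; clear -h2 h4 ueg; lia.
Qed.

Lemma three_units_add_sqr p m w : three_units p m -> w = 0 \/ ~ (p | w) -> four_squares_ndiv p (m + w ^ 2).
Proof.
move=> [x [y [z [-> [ux [uy uz]]]]]] hw.
by exists x, y, z, w; split=> //; right.
Qed.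

(** Isolated as a property of [p] because [p = 5] needs a different argument. *)
Definition three_units_suffice (p : Z) : Prop := forall a b c d,
  ~ (p | a) -> ~ (p | b) -> ~ (p | c) -> (p | d) -> d <> 0 ->
  (a ^ 2 + b ^ 2 + c ^ 2 + d ^ 2) mod 3 <> 1 -> ~ (p | a ^ 2 + b ^ 2 + c ^ 2 + d ^ 2) ->
  four_squares_ndiv p (a ^ 2 + b ^ 2 + c ^ 2 + d ^ 2).

Lemma three_units_suffice_not5 p : Znumtheory.prime p -> 3 < p -> ~ (p | 5) ->
  three_units_suffice p.
Proof.
move=> pp p3 np5 a b c d ua ub uc pd d0 hn _.
(* With [d] in front, every triple given by [pattern3_exists] contains the multiple of [p]. *)
rewrite (_ : _ + d ^ 2 = d ^ 2 + a ^ 2 + b ^ 2 + c ^ 2) in hn *; last by ring.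
have two x y : ~ (p | x) -> ~ (p | y) -> pattern3 d x y -> three_units p (x ^ 2 + y ^ 2 + d ^ 2).
  move=> ux uy h; apply: two_units => //; first by left.
  case: h => [h|[h1 h2 h3]]; [left|right] => //.
  by move: h; congr (_ mod _ = _); ring.
have [h|h|h] := pattern3_exists hn.
- rewrite (_ : _ + c ^ 2 = (a ^ 2 + b ^ 2 + d ^ 2) + c ^ 2); last by ring.
  by apply: three_units_add_sqr; [exact: two|right].
- rewrite (_ : _ + c ^ 2 = (a ^ 2 + c ^ 2 + d ^ 2) + b ^ 2); last by ring.
  by apply: three_units_add_sqr; [exact: two|right].
- rewrite (_ : _ + c ^ 2 = (b ^ 2 + c ^ 2 + d ^ 2) + a ^ 2); last by ring.
  by apply: three_units_add_sqr; [exact: two|right].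
Qed.

Lemma pattern3_mod3 x y z : pattern3 x y z -> (x ^ 2 + y ^ 2 + z ^ 2) mod 3 <> 1.
Proof.
case=> [-> //|[/sqr_mod3_0 hx /sqr_mod3_0 hy /sqr_mod3_0 hz]].
by move: (x ^ 2) (y ^ 2) (z ^ 2) hx hy hz => a b c; clear; lia.
Qed.

Lemma pattern3_rot x y z : pattern3 x y z -> pattern3 y z x.
Proof.
case=> [h|[? ? ?]]; [left|by right].
by move: h; congr (_ mod _ = _); ring.
Qed.

(** Case distinction on the number of coordinates prime to [p]: with one or two, a triple is
    reflected into three units, unless the others are zero; with three, [S] treats a nonzero
    multiple of [p] in fourth place. *)
Lemma four_squares_ndiv_of_three_units p n a b c d : Znumtheory.prime p -> 3 < p ->
  three_units_suffice p -> n = a ^ 2 + b ^ 2 + c ^ 2 + d ^ 2 ->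
  n mod 3 <> 1 -> ~ (p | n) -> four_squares_ndiv p n.
Proof.
move=> pp p3 S en n3 pn.
have extend m w : n = m + w ^ 2 -> three_units p m -> four_squares_ndiv p n.
  move=> e [x [y [z [em [ux [uy uz]]]]]].
  have [pw|uw] := classic (p | w); last by rewrite e; apply: three_units_add_sqr; [exists x, y, z|right].
  have [w0|w0] := Z.eq_dec w 0; first by rewrite e; apply: three_units_add_sqr; [exists x, y, z|left].
  by rewrite e em in n3 pn *; apply: S.
have one e f g h : n = e ^ 2 + f ^ 2 + g ^ 2 + h ^ 2 ->
    ~ (p | e) -> (p | f) -> (p | g) -> (p | h) -> four_squares_ndiv p n.
  move=> E ue pf pg ph; rewrite E in n3.
  have [P|P|P] := pattern3_exists n3; have := pattern3_mod3 P => P3.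
  - by apply: (extend (e ^ 2 + f ^ 2 + g ^ 2) h); [rewrite E; ring|exact: one_unit].
  - by apply: (extend (e ^ 2 + f ^ 2 + h ^ 2) g); [rewrite E; ring|exact: one_unit].
  - by apply: (extend (e ^ 2 + g ^ 2 + h ^ 2) f); [rewrite E; ring|exact: one_unit].
(* The triple is chosen around the nonzero multiple [f] of [p]: it contains both units, or one unit
   and two multiples of [p]. *)
have two' f e g h : n = f ^ 2 + e ^ 2 + g ^ 2 + h ^ 2 ->
    ~ (p | e) -> ~ (p | g) -> (p | f) -> (p | h) -> f <> 0 -> four_squares_ndiv p n.
  move=> E ue ug pf ph f0; rewrite E in n3.
  have [P|P|P] := pattern3_exists n3.
  - apply: (extend (e ^ 2 + g ^ 2 + f ^ 2) h); first by rewrite E; ring.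
    apply: two_units => //; last exact: pattern3_rot.
    apply: equal_squares_mod5 => // h'; apply: pn; rewrite E.
    apply: (divide_comb (i := 1) (j := 1) h' (b := f * f + h * h)); last by ring.
    by apply: Z.divide_add_r; apply: Z.divide_mul_r.
  - apply: (extend (e ^ 2 + h ^ 2 + f ^ 2) g); first by rewrite E; ring.
    by apply: one_unit => //; apply: pattern3_mod3; exact: pattern3_rot.
  - apply: (extend (g ^ 2 + h ^ 2 + f ^ 2) e); first by rewrite E; ring.
    by apply: one_unit => //; apply: pattern3_mod3; exact: pattern3_rot.
have two e g f h : n = e ^ 2 + g ^ 2 + f ^ 2 + h ^ 2 ->
    ~ (p | e) -> ~ (p | g) -> (p | f) -> (p | h) -> four_squares_ndiv p n.
  move=> E ue ug pf ph.
  have [f0|f0] := Z.eq_dec f 0; last by apply: (two' f e g h) => //; rewrite E; ring.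
  have [h0|h0] := Z.eq_dec h 0; last by apply: (two' h e g f) => //; rewrite E; ring.
  by exists e, g, f, h; split; by [|right|left].
have three x y z w : n = x ^ 2 + y ^ 2 + z ^ 2 + w ^ 2 ->
    ~ (p | x) -> ~ (p | y) -> ~ (p | z) -> four_squares_ndiv p n.
  by move=> E ux uy uz; apply: (extend (x ^ 2 + y ^ 2 + z ^ 2) w) => //; exists x, y, z.
have [pa|ua] := classic (p | a); have [pb|ub] := classic (p | b);
have [pc|uc] := classic (p | c); have [pd|ud] := classic (p | d).
- case: pn; rewrite en; rewrite !Z.pow_2_r.
  by repeat (apply: Z.divide_add_r); apply: Z.divide_mul_r.
- by apply: (one d a b c) => //; rewrite en; ring.
- by apply: (one c a b d) => //; rewrite en; ring.
- by apply: (two c d a b) => //; rewrite en; ring.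
- by apply: (one b a c d) => //; rewrite en; ring.
- by apply: (two b d a c) => //; rewrite en; ring.
- by apply: (two b c a d) => //; rewrite en; ring.
- by apply: (three b c d a) => //; rewrite en; ring.
- by apply: (one a b c d) => //; rewrite en; ring.
- by apply: (two a d b c) => //; rewrite en; ring.
- by apply: (two a c b d) => //; rewrite en; ring.
- by apply: (three a c d b) => //; rewrite en; ring.
- by apply: (two a b c d) => //; rewrite en; ring.
- by apply: (three a b d c) => //; rewrite en; ring.
- exact: (three a b c d).
- exact: (three a b c d).
Qed.

(** * The prime 5: a search modulo 405 *)

Definition vec : Type := Z * Z * Z * Z.

Definition dot (v x : vec) : Z :=
  let '(v1, v2, v3, v4) := v in let '(x1, x2, x3, x4) := x in
  v1 * x1 + v2 * x2 + v3 * x3 + v4 * x4.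

Definition axpy (t : Z) (v x : vec) : vec :=
  let '(v1, v2, v3, v4) := v in let '(x1, x2, x3, x4) := x in
  (x1 + t * v1, x2 + t * v2, x3 + t * v3, x4 + t * v4).

Definition reflect (v x : vec) : vec := axpy (-2 * (dot v x / 3)) v x.

(* One of each pair [v], [- v] of vectors with three entries [1] or [-1] and one [0]. *)
Definition roots : seq vec :=
  [:: (1, 1, 1, 0); (1, 1, -1, 0); (1, -1, 1, 0); (1, -1, -1, 0);
      (1, 1, 0, 1); (1, 1, 0, -1); (1, -1, 0, 1); (1, -1, 0, -1);
      (1, 0, 1, 1); (1, 0, 1, -1); (1, 0, -1, 1); (1, 0, -1, -1);
      (0, 1, 1, 1); (0, 1, 1, -1); (0, 1, -1, 1); (0, 1, -1, -1)].

(* The shape to which [two_units] applies: [(a, b, d)] is treated with [c] set aside. *)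
Definition equal_pair (x : vec) : bool := let '(a, b, c, d) := x in
  [&& ~~ (a mod 5 =? 0), ~~ (b mod 5 =? 0), (a ^ 2 - b ^ 2) mod 5 =? 0,
      ~~ (c mod 5 =? 0), c mod 3 =? 0 & d mod 5 =? 0].

Definition all_units (x : vec) : bool := let '(a, b, c, d) := x in
  [&& ~~ (a mod 5 =? 0), ~~ (b mod 5 =? 0), ~~ (c mod 5 =? 0) & ~~ (d mod 5 =? 0)].

(** Orderings up to exchange of the first two entries, in which [equal_pair] is symmetric. *)
Definition arrangements (x : vec) : seq vec := let '(a, b, c, d) := x in
  [:: (a, b, c, d); (a, c, b, d); (b, c, a, d); (a, b, d, c); (a, d, b, c); (b, d, a, c);
      (a, c, d, b); (a, d, c, b); (c, d, a, b); (b, c, d, a); (b, d, c, a); (c, d, b, a)].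

Definition terminal (x : vec) : bool := all_units x || has equal_pair (arrangements x).

(* Conditionals instead of [||] and [&&], whose arguments [vm_compute] evaluates eagerly. *)
Fixpoint reaches (k : nat) (r : vec) : bool :=
  if terminal r then true
  else if k is k'.+1 then
    List.existsb (fun v => if dot v r mod 3 =? 0 then reaches k' (reflect v r) else false) roots
  else false.

Definition lifts (m : Z) (r : vec) : seq vec := let '(a, b, c, d) := r in
  [seq (a + m * e, b + m * f.1, c, d + m * f.2)
     | e <- [:: 0; 1; 2], f <- [seq (g, h) | g <- [:: 0; 1; 2], h <- [:: 0; 1; 2]]].

(* A class modulo [15 * 3 ^ k] that reaches no terminal class in [k] reflections is split
   into its 27 lifts modulo [15 * 3 ^ (k + 1)] with third entry [1]. *)
Fixpoint covered (final : vec -> bool) (n k : nat) (r : vec) : bool :=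
  if reaches k r then true
  else if n is n'.+1 then List.forallb (covered final n' k.+1) (lifts (15 * 3 ^ Z.of_nat k) r)
  else final r.

Definition on_line (w : vec) (m : Z) (x : vec) : bool :=
  let '(p, q, r, s) := w in let '(a, b, c, d) := x in
  [&& (r * a - p * c) mod m =? 0, (r * b - q * c) mod m =? 0 & (r * d - s * c) mod m =? 0].

Definition exceptional : seq vec := [:: (3, 3, 4, 5); (-3, -3, 1, 5); (6, 6, -2, 5)].

(** The starting class is [(2, 2, 1, 0)] modulo 5 and [(0, 0, 1, -1)] modulo 3. Three liftings lead
    to the modulus [15 * 27 = 5 * 81]. *)
Lemma covered_all :
  covered (fun r => has (fun w => on_line w 81 r) exceptional) 3 0 (12, 12, 1, 5).
Proof. by vm_compute. Qed.

(** * Soundness of the search *)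

(* [x] is congruent to the multiple [c r]; the scalar [c] will be the third entry of [x]. *)
Definition near (m c : Z) (r x : vec) : Prop :=
  let '(r1, r2, r3, r4) := r in let '(x1, x2, x3, x4) := x in
  [/\ (m | x1 - c * r1), (m | x2 - c * r2), (m | x3 - c * r3) & (m | x4 - c * r4)].

Lemma dot_reflect v x : dot v v = 3 -> dot v x mod 3 = 0 ->
  dot (reflect v x) (reflect v x) = dot x x.
Proof.
rewrite /reflect; set t := _ / 3 => hv hx.
have ht : dot v x = 3 * t by rewrite /t; lia.
transitivity (dot x x - 4 * t * dot v x + 4 * t ^ 2 * dot v v).
  by case: (v) (x) => [[[? ?] ?] ?] [[[? ?] ?] ?]; rewrite /dot /axpy; ring.
by rewrite ht hv; ring.
Qed.

(** The coefficient [dot v x / 3] is determined modulo [m] only if [x] is known modulo [3 m]: each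
    reflection costs a factor 3 of the modulus. *)
Lemma near_reflect m c v r x : dot v r mod 3 = 0 -> near (3 * m) c r x ->
  dot v x mod 3 = 0 /\ near m c (reflect v r) (reflect v x).
Proof.
move=> hr hrx.
have [f [hf Hf]] : exists f, dot v x = c * dot v r + 3 * m * f /\ forall t,
    near m c (axpy (-2 * t) v r) (axpy (-2 * (c * t + m * f)) v x).
  case: v r x hrx {hr} => [[[v1 v2] v3] v4] [[[r1 r2] r3] r4] [[[x1 x2] x3] x4].
  case=> [[f1 h1] [f2 h2] [f3 h3] [f4 h4]].
  exists (v1 * f1 + v2 * f2 + v3 * f3 + v4 * f4); rewrite /dot; split.
    have -> : x1 = c * r1 + f1 * (3 * m) by lia.
    have -> : x2 = c * r2 + f2 * (3 * m) by lia.
    have -> : x3 = c * r3 + f3 * (3 * m) by lia.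
    have -> : x4 = c * r4 + f4 * (3 * m) by lia.
    by ring.
  move=> t; set f := v1 * f1 + _ + _ + _; rewrite /near /axpy; clearbody f.
  by split; [exists (3 * f1 - 2 * f * v1)|exists (3 * f2 - 2 * f * v2)|
    exists (3 * f3 - 2 * f * v3)|exists (3 * f4 - 2 * f * v4)]; lia.
have [t ht] : exists t, dot v r = t * 3 by exists (dot v r / 3); lia.
have hu : dot v x = (c * t + m * f) * 3 by rewrite hf ht; ring.
split; first by rewrite hu Z.mod_mul.
by rewrite /reflect ht hu !Z.div_mul.
Qed.

Lemma near_divide q m c r x : Znumtheory.prime q -> ~ (q | c) -> (q | m) ->
  (m | x - c * r) -> (q | x) <-> (q | r).
Proof.
move=> qq qc qm mx; have h := Z.divide_trans _ _ _ qm mx; split=> h'.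
- have : (q | c * r) by apply: (divide_comb (i := 1) (j := -1) h' h); lia.
  by move/(prime_mult q qq)=> [].
- by apply: (divide_comb (i := 1) (j := c) h h'); lia.
Qed.

Lemma prime_5 : Znumtheory.prime 5.
Proof.
apply/prime_alt; split=> // n hn [q hq].
have : n = 2 \/ n = 3 \/ n = 4 by lia.
by move=> [|[|]] e; rewrite e in hq; lia.
Qed.

(** As 3 divides [c], the other three squares sum to 2 modulo 3, which is the first case of
    [pattern3]. *)
Lemma equal_pair_ndiv a b c d : equal_pair (a, b, c, d) ->
  (a ^ 2 + b ^ 2 + c ^ 2 + d ^ 2) mod 3 = 2 -> four_squares_ndiv 5 (a ^ 2 + b ^ 2 + c ^ 2 + d ^ 2).
Proof.
case/and5P=> /Z.eqb_spec/divide5 ua /Z.eqb_spec/divide5 ub /Z.eqb_spec/divide5 eab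
  /Z.eqb_spec/divide5 uc /andP[/Z.eqb_spec c3 /Z.eqb_spec/divide5 pd].
rewrite (_ : _ + d ^ 2 = (a ^ 2 + b ^ 2 + d ^ 2) + c ^ 2); last by ring.
move=> hn.
have [d0|d0] := Z.eq_dec d 0.
  by rewrite d0; exists a, b, 0, c; split; [ring|right|right|left|right].
apply: three_units_add_sqr; last by right.
apply: two_units => //; [exact: prime_5|by right|left].
by move: (_ + d ^ 2) (c ^ 2) (sqr_mod3_0 c3) hn => u v; clear; lia.
Qed.

(** The conditions are homogeneous and modulo 3 and 5, so scaling by [c] prime to 15 preserves
    them. *)
Lemma equal_pair_near c r x : ~ (3 | c) -> ~ (5 | c) -> near 15 c r x ->
  equal_pair r -> equal_pair x.
Proof.
case: r x => [[[r1 r2] r3] r4] [[[x1 x2] x3] x4] c3 c5 [h1 h2 h3 h4].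
have p15 : (5 | 15) by exists 3.
have t15 : (3 | 15) by exists 5.
have mod0 q a b : Znumtheory.prime q -> ~ (q | c) -> (q | 15) -> (15 | a - c * b) ->
    (a mod q =? 0) = (b mod q =? 0).
  move=> qq qc q15 hab; have q0 : q <> 0 by have := prime_ge_2 _ qq; lia.
  have h := near_divide qq qc q15 hab.
  by apply/idP/idP => /Z.eqb_spec/(Z.mod_divide _ _ q0)/h/(Z.mod_divide _ _ q0)/Z.eqb_spec.
have m5 a b : (15 | a - c * b) -> (a mod 5 =? 0) = (b mod 5 =? 0).
  by apply: mod0 => //; exact: prime_5.
rewrite /equal_pair (m5 _ _ h1) (m5 _ _ h2) (m5 _ _ h3) (m5 _ _ h4) (mod0 3 _ _ prime_3 c3 t15 h3).
case/and5P=> -> -> /Z.eqb_spec/divide5 h -> -> /=; rewrite andbT.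
apply/Z.eqb_spec/divide5.
have h1' := Z.divide_trans _ _ _ p15 h1; have h2' := Z.divide_trans _ _ _ p15 h2.
have e : x1 ^ 2 - x2 ^ 2 = (x1 + c * r1) * (x1 - c * r1) + - (x2 + c * r2) * (x2 - c * r2)
  + c ^ 2 * (r1 ^ 2 - r2 ^ 2) by ring.
by rewrite e; repeat (apply: Z.divide_add_r); apply: Z.divide_mul_r.
Qed.

Lemma all_units_near c r x : ~ (3 | c) -> ~ (5 | c) -> near 15 c r x ->
  all_units r -> all_units x.
Proof.
case: r x => [[[r1 r2] r3] r4] [[[x1 x2] x3] x4] c3 c5 [h1 h2 h3 h4].
have mod0 a b : (15 | a - c * b) -> (b mod 5 =? 0) = false -> (a mod 5 =? 0) = false.
  move=> hab /Z.eqb_spec/divide5 hb; apply/Z.eqb_spec/divide5.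
  by rewrite (near_divide prime_5 c5 _ hab) //; exists 3.
case/and4P=> /negbTE u1 /negbTE u2 /negbTE u3 /negbTE u4.
by rewrite /all_units !(mod0 _ _ h1, mod0 _ _ h2, mod0 _ _ h3, mod0 _ _ h4).
Qed.

Lemma terminal_ndiv c r x : ~ (3 | c) -> ~ (5 | c) -> near 15 c r x ->
  dot x x mod 3 = 2 -> terminal r -> four_squares_ndiv 5 (dot x x).
Proof.
move=> c3 c5 hrx hx; rewrite /terminal; case/orP=> [/(all_units_near c3 c5 hrx) h|].
  case: x h {hrx hx} => [[[a b] cc] d] /and4P[/Z.eqb_spec/divide5 ua /Z.eqb_spec/divide5 ub
    /Z.eqb_spec/divide5 uc /Z.eqb_spec/divide5 ud].
  by exists a, b, cc, d; split; [rewrite /dot; ring|right|right|right|right].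
case: r x hrx hx => [[[r1 r2] r3] r4] [[[x1 x2] x3] x4] [h1 h2 h3 h4] hn.
have use r' x' : near 15 c r' x' -> dot x' x' = dot (x1, x2, x3, x4) (x1, x2, x3, x4) ->
    equal_pair r' -> four_squares_ndiv 5 (dot (x1, x2, x3, x4) (x1, x2, x3, x4)).
  move=> hr' e /(equal_pair_near c3 c5 hr'); move: hn; rewrite -e.
  case: x' {e hr'} => [[[a b] c'] d].
  rewrite (_ : dot _ _ = a ^ 2 + b ^ 2 + c' ^ 2 + d ^ 2); last by rewrite /dot; ring.
  by move=> hn /equal_pair_ndiv; apply.
cbn [has arrangements]; rewrite orbF; repeat case/orP;
  [apply: (use _ (x1, x2, x3, x4))|apply: (use _ (x1, x3, x2, x4))
  |apply: (use _ (x2, x3, x1, x4))|apply: (use _ (x1, x2, x4, x3))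
  |apply: (use _ (x1, x4, x2, x3))|apply: (use _ (x2, x4, x1, x3))
  |apply: (use _ (x1, x3, x4, x2))|apply: (use _ (x1, x4, x3, x2))
  |apply: (use _ (x3, x4, x1, x2))|apply: (use _ (x2, x3, x4, x1))
  |apply: (use _ (x2, x4, x3, x1))|apply: (use _ (x3, x4, x2, x1))];
  by [split|rewrite /dot; ring].
Qed.

Lemma roots_norm v : List.In v roots -> dot v v = 3.
Proof. by rewrite /=; repeat case=> [<- //|]. Qed.

Lemma reachesS k r : reaches k.+1 r =
  if terminal r then true
  else List.existsb (fun v => if dot v r mod 3 =? 0 then reaches k (reflect v r) else false) roots.
Proof. by []. Qed.

Lemma reaches_ndiv k c r x : ~ (3 | c) -> ~ (5 | c) -> near (15 * 3 ^ Z.of_nat k) c r x ->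
  dot x x mod 3 = 2 -> reaches k r -> four_squares_ndiv 5 (dot x x).
Proof.
move=> c3 c5; elim: k r x => [|k IH] r x hrx hx; rewrite ?reachesS; [rewrite /reaches|]; case: ifP => [|_] //.
- by move=> ht _; exact: (terminal_ndiv c3 c5 hrx hx ht).
- move=> ht _; apply: (terminal_ndiv c3 c5 _ hx ht).
  case: r x hrx {hx ht} => [[[r1 r2] r3] r4] [[[x1 x2] x3] x4].
  have h15 : (15 | 15 * 3 ^ Z.of_nat k.+1) by exact: Z.divide_factor_l.
  by move=> [] h1 h2 h3 h4; split; apply: Z.divide_trans h15 _.
- case/List.existsb_exists=> v [/roots_norm hv]; case: ifP => // /Z.eqb_spec hr hreach.
  rewrite pow3_succ (_ : 15 * _ = 3 * (15 * 3 ^ Z.of_nat k)) in hrx; last by ring.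
  have [hx0 hnear] := near_reflect hr hrx.
  by rewrite -(dot_reflect hv hx0) in hx *; apply: IH hnear hx hreach.
Qed.

Lemma coveredS final n k r : covered final n.+1 k r =
  if reaches k r then true
  else List.forallb (covered final n k.+1) (lifts (15 * 3 ^ Z.of_nat k) r).
Proof. by []. Qed.

Lemma covered_ndiv final n k c x1 x2 x4 r1 r2 r4 : ~ (3 | c) -> ~ (5 | c) ->
  near (15 * 3 ^ Z.of_nat k) c (r1, r2, 1, r4) (x1, x2, c, x4) ->
  dot (x1, x2, c, x4) (x1, x2, c, x4) mod 3 = 2 -> covered final n k (r1, r2, 1, r4) ->
  four_squares_ndiv 5 (dot (x1, x2, c, x4) (x1, x2, c, x4)) \/
  exists s1 s2 s4, near (15 * 3 ^ Z.of_nat (k + n)) c (s1, s2, 1, s4) (x1, x2, c, x4) /\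
    final (s1, s2, 1, s4).
Proof.
move=> c3 c5; elim: n k r1 r2 r4 => [|n IH] k r1 r2 r4 hrx hx.
  rewrite /covered; case: ifP => [h _|_ h]; first by left; exact: (reaches_ndiv c3 c5 hrx hx h).
  by right; exists r1, r2, r4; rewrite addn0.
rewrite coveredS; case: ifP => [h _|_].
  by left; exact: (reaches_ndiv c3 c5 hrx hx h).
move=> hall.
have {}hall := (List.forallb_forall _ _).1 hall.
(* [c] is invertible modulo 3, so each quotient by [c] has a next 3-adic digit [e]. The third entry
   of the vector is [c] itself and needs no digit. *)
have digit f : exists e, (e = 0 \/ e = 1 \/ e = 2) /\ (3 | f - c * e).
  have hc : c mod 3 <> 0 by move=> c0; apply: c3; apply/Z.mod_divide.
  have [h0|[h1|h2]] : f mod 3 = 0 \/ (f - c) mod 3 = 0 \/ (f - 2 * c) mod 3 = 0.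
    by clear -hc; lia.
  - exists 0; split; first by left.
    by apply/Z.mod_divide => //; rewrite Z.mul_0_r Z.sub_0_r.
  - exists 1; split; first by right; left.
    by apply/Z.mod_divide => //; rewrite Z.mul_1_r.
  - exists 2; split; first by right; right.
    by apply/Z.mod_divide => //; rewrite Z.mul_comm.
set m := 15 * 3 ^ Z.of_nat k in hrx hall.
have hm : 15 * 3 ^ Z.of_nat k.+1 = 3 * m by rewrite pow3_succ /m; ring.
clearbody m; case: hrx => [[f1 h1] [f2 h2] h3 [f4 h4]].
have [e1 [he1 [g1 hg1]]] := digit f1; have [e2 [he2 [g2 hg2]]] := digit f2.
have [e4 [he4 [g4 hg4]]] := digit f4.
rewrite addnS -addSn; apply: (IH k.+1 (r1 + m * e1) (r2 + m * e2) (r4 + m * e4)) => //.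
  rewrite hm; split; [exists g1|exists g2|exists 0; ring|exists g4].
  - transitivity ((x1 - c * r1) - m * c * e1); first by ring.
    by rewrite h1 (_ : f1 = g1 * 3 + c * e1); [ring|lia].
  - transitivity ((x2 - c * r2) - m * c * e2); first by ring.
    by rewrite h2 (_ : f2 = g2 * 3 + c * e2); [ring|lia].
  - transitivity ((x4 - c * r4) - m * c * e4); first by ring.
    by rewrite h4 (_ : f4 = g4 * 3 + c * e4); [ring|lia].
apply: hall; clear -he1 he2 he4; rewrite /lifts /=.
by move: he1 he2 he4 => [->|[->|->]] [->|[->|->]] [->|[->|->]]; do 27?[by left|right].
Qed.

(* Modulo 5 the vector is [c (2, 2, 1, 0)], so [c] carries the exceptional square class. *)
Definition type_I (a b c d : Z) : Prop :=
  [/\ (a - 2 * c) mod 5 = 0, (b - 2 * c) mod 5 = 0, d mod 5 = 0 & c mod 5 <> 0] /\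
  [/\ a mod 3 = 0, b mod 3 = 0, c mod 3 <> 0 & (c + d) mod 3 = 0].

(** Proportionality to [(p, p, q, r)] modulo [m], cross-multiplied with the third entries. *)
Definition line (p q r m a b c d : Z) : Prop :=
  [/\ (m | q * a - p * c), (m | q * b - p * c) & (m | q * d - r * c)].

Lemma type_I_mod81 a b c d n : n = a ^ 2 + b ^ 2 + c ^ 2 + d ^ 2 -> type_I a b c d ->
  ~ four_squares_ndiv 5 n -> [\/ line 3 4 5 81 a b c d, line (-3) 1 5 81 a b c d | line 6 (-2) 5 81 a b c d].
Proof.
move=> en [[ha hb hd hc] [a3 b3 c3 cd3]] ng.
have e : dot (a, b, c, d) (a, b, c, d) = n by rewrite en /dot; ring.
have c3' : ~ (3 | c) by move/Z.mod_divide => h; apply: c3; apply: h.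
have c5' : ~ (5 | c) by move/Z.mod_divide => h; apply: hc; apply: h.
have hnear : near 15 c (12, 12, 1, 5) (a, b, c, d).
  by split; apply/Z.mod_divide => //; clear -ha hb hd a3 b3 cd3; lia.
have hmod : dot (a, b, c, d) (a, b, c, d) mod 3 = 2.
  rewrite e en; clear -a3 b3 c3 cd3.
  have d3 : d mod 3 <> 0 by lia.
  move: (sqr_mod3_0 a3) (sqr_mod3_0 b3) (sqr_mod3_1 c3) (sqr_mod3_1 d3); clear.
  by move: (a ^ 2) (b ^ 2) (c ^ 2) (d ^ 2) => u v w t; lia.
have [|[s1 [s2 [s4 [hs]]]]] := covered_ndiv c3' c5' (k := 0) hnear hmod covered_all.
  by rewrite e.
have to_line w p q r : w = (p, p, q, r) -> on_line w 81 (s1, s2, 1, s4) -> line p q r 81 a b c d.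
  move=> ->; case/and3P=> /Z.eqb_spec h1 /Z.eqb_spec h2 /Z.eqb_spec h3.
  have h405 : (81 | 15 * 3 ^ Z.of_nat (0 + 3)) by exists 5.
  case: hs => k1 k2 _ k4.
  have scale s u x : (81 | x - c * s) -> (q * s - u * 1) mod 81 = 0 -> (81 | q * x - u * c).
    move=> hx /Z.mod_divide hq.
    by apply: (divide_comb (i := q) (j := c) hx (hq _)) => //; ring.
  by split; [apply: scale h1|apply: scale h2|apply: scale h3]; apply: Z.divide_trans h405 _.
rewrite /exceptional; cbn [has]; rewrite orbF.
by case/or3P=> h; [constructor 1|constructor 2|constructor 3]; apply: to_line h.
Qed.

(** * The prime 5: exceptional lines *)

Definition on_exceptional_line (m a b c d : Z) : Prop :=
  [\/ line 3 4 5 m a b c d, line (-3) 1 5 m a b c d | line 6 (-2) 5 m a b c d].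

Lemma type_I_swap a b c d : type_I a b c d -> type_I b a c d.
Proof. by case=> [[h1 h2 h3 h4] [h5 h6 h7 h8]]. Qed.

(** All representations of [n] are included, because the induction applies this to isometric images
    of the given one. *)
Definition type_I_on_lines (n m : Z) : Prop := forall a b c d, n = a ^ 2 + b ^ 2 + c ^ 2 + d ^ 2 ->
  type_I a b c d -> on_exceptional_line m a b c d.

Lemma line9 p q r m a b c d : (9 | m) -> line p q r m a b c d ->
  [/\ (q * a - p * c) mod 9 = 0, (q * b - p * c) mod 9 = 0 & (q * d - r * c) mod 9 = 0].
Proof. by move=> h [h1 h2 h3]; split; apply/Z.mod_divide => //; apply: Z.divide_trans h _. Qed.

(** The lines are distinct modulo 9: the first has [a = 3 c], the other two have [a = -3 c] with
    [d = 5 c], resp. [d = 2 c]. *)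
Lemma type_I_on_line1 n e a b c d : type_I_on_lines n (81 * e) -> n = a ^ 2 + b ^ 2 + c ^ 2 + d ^ 2 ->
  type_I a b c d -> (a - 3 * c) mod 9 = 0 -> line 3 4 5 (81 * e) a b c d.
Proof.
move=> S en h h9; have h81 : (9 | 81 * e) by exists (9 * e); ring.
have [] // := S a b c d en h; case: h => [_ [_ _ c3 _]].
  by move/(line9 h81)=> [h1 _ _]; exfalso; clear -h1 h9 c3; lia.
by move/(line9 h81)=> [h1 _ _]; exfalso; clear -h1 h9 c3; lia.
Qed.

Lemma type_I_on_line2 n e a b c d : type_I_on_lines n (81 * e) -> n = a ^ 2 + b ^ 2 + c ^ 2 + d ^ 2 ->
  type_I a b c d -> (a + 3 * c) mod 9 = 0 -> (d - 5 * c) mod 9 = 0 ->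
  line (-3) 1 5 (81 * e) a b c d.
Proof.
move=> S en h h9 h9'; have h81 : (9 | 81 * e) by exists (9 * e); ring.
have [] // := S a b c d en h; case: h => [_ [_ _ c3 _]].
  by move/(line9 h81)=> [h1 _ _]; exfalso; clear -h1 h9 c3; lia.
by move/(line9 h81)=> [_ _ h1]; exfalso; clear -h1 h9' c3; lia.
Qed.

Lemma type_I_on_line3 n e a b c d : type_I_on_lines n (81 * e) -> n = a ^ 2 + b ^ 2 + c ^ 2 + d ^ 2 ->
  type_I a b c d -> (a + 3 * c) mod 9 = 0 -> (d - 2 * c) mod 9 = 0 ->
  line 6 (-2) 5 (81 * e) a b c d.
Proof.
move=> S en h h9 h9'; have h81 : (9 | 81 * e) by exists (9 * e); ring.
have [] // := S a b c d en h; case: h => [_ [_ _ c3 _]].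
  by move/(line9 h81)=> [h1 _ _]; exfalso; clear -h1 h9 c3; lia.
by move/(line9 h81)=> [_ _ h1]; exfalso; clear -h1 h9' c3; lia.
Qed.

Lemma cancel_pos m u v : 0 < m -> m * u = m * v -> u = v.
Proof. by move=> m0; apply: Z.mul_reg_l; lia. Qed.

(* Both isometries used below fix the direction [(3, 3, 4, 5)] and preserve [type_I], but
   they have denominators 3 and 9, so applying [type_I_on_lines] to the images gains a factor 3. The
   same idea is used for the other two lines. *)
Lemma line1_step n e a b c d A D : 0 < e -> type_I_on_lines n (81 * e) ->
  n = a ^ 2 + b ^ 2 + c ^ 2 + d ^ 2 -> type_I a b c d ->
  4 * a - 3 * c = 81 * e * A -> (81 | 4 * b - 3 * c) -> 4 * d - 5 * c = 81 * e * D ->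
  A mod 3 = 0 /\ D mod 3 = 0.
Proof.
move=> e0 S en [[ha hb hd hc] [a3 b3 c3 cd3]] eA [v eB] eD.
have [u eA'] : exists u, 4 * a - 3 * c = 81 * u by exists (e * A); rewrite eA; ring.
have [w eD'] : exists w, 4 * d - 5 * c = 81 * w by exists (e * D); rewrite eD; ring.
(* [A] and [D] measure the deviation from the line; two isometries give independent linear
   congruences for them modulo 3. *)
have hT : (A + D) mod 3 = 0.
  have [y2 h2] : exists y, 3 * y = 2 * a + 2 * c - d.
    by exists ((2 * a + 2 * c - d) / 3); clear -eA' eD' a3 c3 cd3; lia.
  have [y3 h3] : exists y, 3 * y = 2 * a - c + 2 * d.
    by exists ((2 * a - c + 2 * d) / 3); clear -eA' eD' a3 c3 cd3; lia.
  have [y4 h4] : exists y, 3 * y = - a + 2 * c + 2 * d.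
    by exists ((- a + 2 * c + 2 * d) / 3); clear -eA' eD' a3 c3 cd3; lia.
  have en' : n = b ^ 2 + y2 ^ 2 + y3 ^ 2 + y4 ^ 2.
    apply: (@cancel_pos 9) => //.
    transitivity (9 * b ^ 2 + (3 * y2) ^ 2 + (3 * y3) ^ 2 + (3 * y4) ^ 2); last by ring.
    by rewrite h2 h3 h4 en; ring.
  have [||_ [g hg] _] := type_I_on_line1 S en'.
  - split; split; clear -h2 h3 h4 ha hb hd hc a3 b3 c3 cd3 eA' eB eD'; lia.
  - clear -h2 h3 h4 eA' eB eD'; lia.
  have : A - 5 * D = 6 * g.
    by apply: (@cancel_pos (81 * e)); [clear -e0|clear -hg h2 h3 eA eD]; lia.
  by clear; lia.
have hR : (A - D) mod 3 = 0.
  have [y1 h1] : exists y, 9 * y = a - 4 * c + 8 * d.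
    by exists ((a - 4 * c + 8 * d) / 9); clear -eA' eD'; lia.
  have [y3 h3] : exists y, 9 * y = -4 * a + 7 * c + 4 * d.
    by exists ((-4 * a + 7 * c + 4 * d) / 9); clear -eA' eD'; lia.
  have [y4 h4] : exists y, 9 * y = 8 * a + 4 * c + d.
    by exists ((8 * a + 4 * c + d) / 9); clear -eA' eD'; lia.
  have en' : n = y1 ^ 2 + b ^ 2 + y3 ^ 2 + y4 ^ 2.
    apply: (@cancel_pos 81) => //.
    transitivity ((9 * y1) ^ 2 + 81 * b ^ 2 + (9 * y3) ^ 2 + (9 * y4) ^ 2); last by ring.
    by rewrite h1 h3 h4 en; ring.
  have [||_ _ [g hg]] := type_I_on_line1 S en'.
  - split; split; clear -h1 h3 h4 ha hb hd hc a3 b3 c3 cd3 eA' eB eD'; lia.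
  - clear -h1 h3 h4 eA' eB eD'; lia.
  have : 13 * A - 4 * D = 9 * g.
    by apply: (@cancel_pos (81 * e)); [clear -e0|clear -hg h3 h4 eA eD]; lia.
  by clear; lia.
by clear -hT hR; lia.
Qed.

Lemma line2_step n e a b c d A D : 0 < e -> type_I_on_lines n (81 * e) ->
  n = a ^ 2 + b ^ 2 + c ^ 2 + d ^ 2 -> type_I a b c d ->
  a + 3 * c = 81 * e * A -> (81 | b + 3 * c) -> d - 5 * c = 81 * e * D ->
  A mod 3 = 0 /\ D mod 3 = 0.
Proof.
move=> e0 S en [[ha hb hd hc] [a3 b3 c3 cd3]] eA [v eB] eD.
have [u eA'] : exists u, a + 3 * c = 81 * u by exists (e * A); rewrite eA; ring.
have [w eD'] : exists w, d - 5 * c = 81 * w by exists (e * D); rewrite eD; ring.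
have hT : (A + D) mod 3 = 0.
  have [y2 h2] : exists y, 3 * y = 2 * a + 2 * c - d.
    by exists ((2 * a + 2 * c - d) / 3); clear -eA' eD' a3 c3 cd3; lia.
  have [y3 h3] : exists y, 3 * y = 2 * a - c + 2 * d.
    by exists ((2 * a - c + 2 * d) / 3); clear -eA' eD' a3 c3 cd3; lia.
  have [y4 h4] : exists y, 3 * y = - a + 2 * c + 2 * d.
    by exists ((- a + 2 * c + 2 * d) / 3); clear -eA' eD' a3 c3 cd3; lia.
  have en' : n = b ^ 2 + y2 ^ 2 + y3 ^ 2 + y4 ^ 2.
    apply: (@cancel_pos 9) => //.
    transitivity (9 * b ^ 2 + (3 * y2) ^ 2 + (3 * y3) ^ 2 + (3 * y4) ^ 2); last by ring.
    by rewrite h2 h3 h4 en; ring.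
  have [|||_ [g hg] _] := type_I_on_line2 S en'.
  - split; split; clear -h2 h3 h4 ha hb hd hc a3 b3 c3 cd3 eA' eB eD'; lia.
  - clear -h2 h3 h4 eA' eB eD'; lia.
  - have -> : y4 - 5 * y3 = 9 * (-33 * u - 24 * w) by clear -h3 h4 eA' eD'; lia.
    by clear; lia.
  have : 8 * A + 5 * D = 3 * g.
    by apply: (@cancel_pos (81 * e)); [clear -e0|clear -hg h2 h3 eA eD]; lia.
  by clear; lia.
(* This isometry sends [(-3, -3, 1, 5)] to its negative, so it still preserves the line. *)
have hS : (A + 2 * D) mod 3 = 0.
  have [y1 h1] : exists y, 3 * y = a + 2 * c + 2 * d.
    by exists ((a + 2 * c + 2 * d) / 3); clear -eA' eD' a3 c3 cd3; lia.
  have [y3 h3] : exists y, 3 * y = 2 * a - 2 * c + d.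
    by exists ((2 * a - 2 * c + d) / 3); clear -eA' eD' a3 c3 cd3; lia.
  have [y4 h4] : exists y, 3 * y = 2 * a + c - 2 * d.
    by exists ((2 * a + c - 2 * d) / 3); clear -eA' eD' a3 c3 cd3; lia.
  have en' : n = y1 ^ 2 + (- b) ^ 2 + y3 ^ 2 + y4 ^ 2.
    apply: (@cancel_pos 9) => //.
    transitivity ((3 * y1) ^ 2 + 9 * b ^ 2 + (3 * y3) ^ 2 + (3 * y4) ^ 2); last by ring.
    by rewrite h1 h3 h4 en; ring.
  have [|||[g hg] _ _] := type_I_on_line2 S en'.
  - split; split; clear -h1 h3 h4 ha hb hd hc a3 b3 c3 cd3 eA' eB eD'; lia.
  - clear -h1 h3 h4 eA' eB eD'; lia.
  - have -> : y4 - 5 * y3 = 9 * (-24 * u - 21 * w) by clear -h3 h4 eA' eD'; lia.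
    by clear; lia.
  have : 7 * A + 5 * D = 3 * g.
    by apply: (@cancel_pos (81 * e)); [clear -e0|clear -hg h1 h3 eA eD]; lia.
  by clear; lia.
by clear -hT hS; lia.
Qed.

Lemma line3_step n e a b c d A D : 0 < e -> type_I_on_lines n (81 * e) ->
  n = a ^ 2 + b ^ 2 + c ^ 2 + d ^ 2 -> type_I a b c d ->
  -2 * a - 6 * c = 81 * e * A -> (81 | -2 * b - 6 * c) -> -2 * d - 5 * c = 81 * e * D ->
  A mod 3 = 0 /\ D mod 3 = 0.
Proof.
move=> e0 S en [[ha hb hd hc] [a3 b3 c3 cd3]] eA [v eB] eD.
have [u eA'] : exists u, -2 * a - 6 * c = 81 * u by exists (e * A); rewrite eA; ring.
have [w eD'] : exists w, -2 * d - 5 * c = 81 * w by exists (e * D); rewrite eD; ring.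
have hR : (A + 2 * D) mod 3 = 0.
  have [y1 h1] : exists y, 9 * y = a - 4 * c + 8 * d.
    by exists ((a - 4 * c + 8 * d) / 9); clear -eA' eD'; lia.
  have [y3 h3] : exists y, 9 * y = -4 * a + 7 * c + 4 * d.
    by exists ((-4 * a + 7 * c + 4 * d) / 9); clear -eA' eD'; lia.
  have [y4 h4] : exists y, 9 * y = 8 * a + 4 * c + d.
    by exists ((8 * a + 4 * c + d) / 9); clear -eA' eD'; lia.
  have en' : n = y1 ^ 2 + b ^ 2 + y3 ^ 2 + y4 ^ 2.
    apply: (@cancel_pos 81) => //.
    transitivity ((9 * y1) ^ 2 + 81 * b ^ 2 + (9 * y3) ^ 2 + (9 * y4) ^ 2); last by ring.
    by rewrite h1 h3 h4 en; ring.
  have [|||[g hg] _ _] := type_I_on_line3 S en'.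
  - split; split; clear -h1 h3 h4 ha hb hd hc a3 b3 c3 cd3 eA' eB eD'; lia.
  - clear -h1 h3 h4 eA' eB eD'; lia.
  - clear -h1 h3 h4 eA' eB eD'; lia.
  have : -11 * A + 20 * D = 9 * g.
    by apply: (@cancel_pos (81 * e)); [clear -e0|clear -hg h1 h3 eA eD]; lia.
  by clear; lia.
(* Here [(6, 6, -2, 5)] is sent to its negative. *)
have hR' : (A + D) mod 3 = 0.
  have [y1 h1] : exists y, 9 * y = -7 * a - 4 * c - 4 * d.
    by exists ((-7 * a - 4 * c - 4 * d) / 9); clear -eA' eD'; lia.
  have [y3 h3] : exists y, 9 * y = -4 * a - c + 8 * d.
    by exists ((-4 * a - c + 8 * d) / 9); clear -eA' eD'; lia.
  have [y4 h4] : exists y, 9 * y = -4 * a + 8 * c - d.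
    by exists ((-4 * a + 8 * c - d) / 9); clear -eA' eD'; lia.
  have en' : n = y1 ^ 2 + (- b) ^ 2 + y3 ^ 2 + y4 ^ 2.
    apply: (@cancel_pos 81) => //.
    transitivity ((9 * y1) ^ 2 + 81 * b ^ 2 + (9 * y3) ^ 2 + (9 * y4) ^ 2); last by ring.
    by rewrite h1 h3 h4 en; ring.
  have [|||[g hg] _ _] := type_I_on_line3 S en'.
  - split; split; clear -h1 h3 h4 ha hb hd hc a3 b3 c3 cd3 eA' eB eD'; lia.
  - clear -h1 h3 h4 eA' eB eD'; lia.
  - clear -h1 h3 h4 eA' eB eD'; lia.
  have : -19 * A + 20 * D = 9 * g.
    by apply: (@cancel_pos (81 * e)); [clear -e0|clear -hg h1 h3 eA eD]; lia.
  by clear; lia.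
by clear -hR hR'; lia.
Qed.

Lemma divide_next m u A : u = m * A -> A mod 3 = 0 -> (3 * m | u).
Proof. by move=> -> h; exists (A / 3); rewrite {1}(_ : A = 3 * (A / 3)); [ring|lia]. Qed.

Lemma type_I_on_lines_pow3 n k : ~ four_squares_ndiv 5 n -> type_I_on_lines n (81 * 3 ^ Z.of_nat k).
Proof.
move=> ng; elim: k => [|k S] a b c d en h; first exact: (type_I_mod81 en).
rewrite pow3_succ; have e0 := pow3_gt0 k; set e := 3 ^ Z.of_nat k in S e0 *; clearbody e.
(* The lines are symmetric in the first two coordinates, so exchanging these gives the congruence
   for [B]. *)
have en' : n = b ^ 2 + a ^ 2 + c ^ 2 + d ^ 2 by rewrite en; ring.
have h' := type_I_swap h.
have h81 x : (81 * e | x) -> (81 | x) by apply: Z.divide_trans; exact: Z.divide_factor_l.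
have comm x y : x = y * (81 * e) -> x = 81 * e * y by move->; ring.
rewrite /on_exceptional_line (_ : 81 * (3 * e) = 3 * (81 * e)); last by ring.
case: (S a b c d en h) => [] [hA hB hD]; case: (hA) (hB) (hD) =>
  [A /comm eA] [B /comm eB] [D /comm eD]; [constructor 1|constructor 2|constructor 3].
- have [A3 D3] := line1_step e0 S en h eA (h81 _ hB) eD.
  have [B3 _] := line1_step e0 S en' h' eB (h81 _ hA) eD.
  by split; [exact: divide_next eA A3|exact: divide_next eB B3|exact: divide_next eD D3].
- have lin x y z : 1 * x - y * z = x - y * z by ring.
  have lin' x z : 1 * x - -3 * z = x + 3 * z by ring.
  rewrite lin' in eA hA; rewrite lin' in eB hB; rewrite lin in eD.
  have [A3 D3] := line2_step e0 S en h eA (h81 _ hB) eD.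
  have [B3 _] := line2_step e0 S en' h' eB (h81 _ hA) eD.
  rewrite /line !lin' lin.
  by split; [exact: divide_next eA A3|exact: divide_next eB B3|exact: divide_next eD D3].
- have [A3 D3] := line3_step e0 S en h eA (h81 _ hB) eD.
  have [B3 _] := line3_step e0 S en' h' eB (h81 _ hA) eD.
  by split; [exact: divide_next eA A3|exact: divide_next eB B3|exact: divide_next eD D3].
Qed.

Lemma eq0_of_divide_pow3 z : (forall k, (81 * 3 ^ Z.of_nat k | z)) -> z = 0.
Proof.
move=> h; have [//|z0] := Z.eq_dec z 0; have [k hk] := not_divide_pow3 z0.
by case: hk; apply: Z.divide_trans (h k); exact: Z.divide_factor_r.
Qed.

(** For a counterexample the congruences hold modulo every [81 * 3 ^ k], with the same line for all
    [k] because the lines differ modulo 9. So they are equalities, and [n] is an explicit multiple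
    of a square. *)
Lemma type_I_ndiv a b c d : type_I a b c d -> four_squares_ndiv 5 (a ^ 2 + b ^ 2 + c ^ 2 + d ^ 2).
Proof.
move=> h; have [//|ng] := classic (four_squares_ndiv 5 (a ^ 2 + b ^ 2 + c ^ 2 + d ^ 2)).
have S k := type_I_on_lines_pow3 k ng erefl h.
have c5 : ~ (5 | c) by move/divide5; case: h => [[]].
have h81 k : (9 | 81 * 3 ^ Z.of_nat k) by exists (9 * 3 ^ Z.of_nat k); ring.
have c3 : c mod 3 <> 0 by case: h => _ [].
case: (S 0%N) => /(line9 (h81 _)) [r1 r2 r3].
- have H k : line 3 4 5 (81 * 3 ^ Z.of_nat k) a b c d.
    case: (S k) => // /(line9 (h81 _)) [s1 s2 s3]; exfalso; clear -r1 r3 s1 s3 c3; lia.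
  have eA := eq0_of_divide_pow3 (fun k => let: And3 h1 _ _ := H k in h1).
  have eB := eq0_of_divide_pow3 (fun k => let: And3 _ h1 _ := H k in h1).
  have eD := eq0_of_divide_pow3 (fun k => let: And3 _ _ h1 := H k in h1).
  have [m hm] : exists m, c = 4 * m by exists (c / 4); clear -eA; lia.
  have -> : a = 3 * m by clear -eA eB eD hm; lia.
  have -> : b = 3 * m by clear -eA eB eD hm; lia.
  have -> : d = 5 * m by clear -eA eB eD hm; lia.
  have m5 : m mod 5 <> 0 by clear -c5 hm; move=> h; apply/c5/divide5; lia.
  exists (7 * m), (3 * m), m, 0; split; first by rewrite hm; ring.
  + by right; move/divide5; clear -m5; lia.
  + by right; move/divide5; clear -m5; lia.
  + by right; move/divide5; clear -m5; lia.
  + by left.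
- have H k : line (-3) 1 5 (81 * 3 ^ Z.of_nat k) a b c d.
    case: (S k) => // /(line9 (h81 _)) [s1 s2 s3]; exfalso; clear -r1 r3 s1 s3 c3; lia.
  have eA := eq0_of_divide_pow3 (fun k => let: And3 h1 _ _ := H k in h1).
  have eB := eq0_of_divide_pow3 (fun k => let: And3 _ h1 _ := H k in h1).
  have eD := eq0_of_divide_pow3 (fun k => let: And3 _ _ h1 := H k in h1).
  have -> : a = -3 * c by clear -eA eB eD; lia.
  have -> : b = -3 * c by clear -eA eB eD; lia.
  have -> : d = 5 * c by clear -eA eB eD; lia.
  have m5 : c mod 5 <> 0 by clear -c5; move=> h; apply/c5/divide5.
  exists (6 * c), (2 * c), (2 * c), 0; split; first by ring.
  + by right; move/divide5; clear -m5; lia.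
  + by right; move/divide5; clear -m5; lia.
  + by right; move/divide5; clear -m5; lia.
  + by left.
- have H k : line 6 (-2) 5 (81 * 3 ^ Z.of_nat k) a b c d.
    case: (S k) => // /(line9 (h81 _)) [s1 s2 s3]; exfalso; clear -r1 r3 s1 s3 c3; lia.
  have eA := eq0_of_divide_pow3 (fun k => let: And3 h1 _ _ := H k in h1).
  have eB := eq0_of_divide_pow3 (fun k => let: And3 _ h1 _ := H k in h1).
  have eD := eq0_of_divide_pow3 (fun k => let: And3 _ _ h1 := H k in h1).
  have [m hm] : exists m, c = -2 * m by exists (- c / 2); clear -eD; lia.
  have -> : a = 6 * m by clear -eA eB eD hm; lia.
  have -> : b = 6 * m by clear -eA eB eD hm; lia.
  have -> : d = 5 * m by clear -eA eB eD hm; lia.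
  have m5 : m mod 5 <> 0 by clear -c5 hm; move=> h; apply/c5/divide5; lia.
  exists (9 * m), (4 * m), (2 * m), 0; split; first by rewrite hm; ring.
  + by right; move/divide5; clear -m5; lia.
  + by right; move/divide5; clear -m5; lia.
  + by right; move/divide5; clear -m5; lia.
  + by left.
Qed.

(** * The prime 5: remaining residues modulo 3 *)

Lemma equal_pair_suffices a b c d : ~ (5 | a) -> ~ (5 | b) -> ~ (5 | c) -> (5 | d) ->
  (5 | a ^ 2 - b ^ 2) -> pattern3 a b d -> four_squares_ndiv 5 (a ^ 2 + b ^ 2 + c ^ 2 + d ^ 2).
Proof.
move=> ua ub uc pd hab hp.
have [->|d0] := Z.eq_dec d 0; first by exists a, b, c, 0; split; [|right|right|right|left].
rewrite (_ : _ + d ^ 2 = (a ^ 2 + b ^ 2 + d ^ 2) + c ^ 2); last by ring.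
by apply: three_units_add_sqr; [apply: two_units => //; [exact: prime_5|right]|right].
Qed.

Lemma sqr_sub_divide p x y : (p | x - y) \/ (p | x + y) -> (p | x ^ 2 - y ^ 2).
Proof.
rewrite (_ : x ^ 2 - y ^ 2 = (x - y) * (x + y)); last by ring.
by case=> h; [apply: Z.divide_mul_l|apply: Z.divide_mul_r].
Qed.

(** [double_descent] on [(x, y, z)] makes 3 divide [X] or [Y] instead of [Z], and modulo 5 the sign
    of [b] can be chosen with [b = X] or [b = - Y]. If 3 divides the coordinate matching [b], the
    result is of type I; otherwise [b] and that coordinate form an equal pair with the right pattern
    modulo 3. *)
Lemma type_II_ndiv x y z b : ~ (5 | y) -> (5 | x - 2 * y) -> (5 | z) -> z <> 0 ->
  ((5 | b - 2 * y) \/ (5 | b + 2 * y)) \/ ((5 | b - y) \/ (5 | b + y)) ->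
  x mod 3 <> 0 -> b mod 3 = 0 -> (x + y) mod 3 = 0 -> z mod 3 = 0 ->
  four_squares_ndiv 5 (x ^ 2 + y ^ 2 + z ^ 2 + b ^ 2).
Proof.
move=> uy hxy hz z0 hb x3 b3 xy3 z3.
have [k hk] := not_divide_pow3 z0.
have [X [Y [Z [-> [h1 h2] h3 h4 [h5 h6]]]]] :=
  double_descent prime_5 (erefl : 3 < 5) hxy hz xy3 z3 x3 (fun h => hk (proj2 h)).
have {}uy : y mod 5 <> 0 by move/divide5.
move: hxy hz h1 h2 h3 hb; rewrite !divide5 => hxy hz h1 h2 h3 hb.
have uY : Y mod 5 <> 0 by clear -uy h3; lia.
have sq0 := sqr_mod3_0 b3.
wlog hb' : b b3 sq0 {hb} / (b - 2 * Y) mod 5 = 0 \/ (b + Y) mod 5 = 0.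
  move=> W; have [h|[h|[h|h]]] : (b - 2 * Y) mod 5 = 0 \/ (b + Y) mod 5 = 0 \/
      (- b - 2 * Y) mod 5 = 0 \/ (- b + Y) mod 5 = 0 by clear -hb h3; lia.
  - by apply: W => //; left.
  - by apply: W => //; right.
  - rewrite (_ : b ^ 2 = (- b) ^ 2); last by ring.
    apply: W; [by clear -b3; lia| |by left].
    by rewrite (_ : (- b) ^ 2 = b ^ 2); last by ring.
  - rewrite (_ : b ^ 2 = (- b) ^ 2); last by ring.
    apply: W; [by clear -b3; lia| |by right].
    by rewrite (_ : (- b) ^ 2 = b ^ 2); last by ring.
have ub : ~ (5 | b) by rewrite divide5; clear -hb' uY; lia.
have uX : X mod 5 <> 0 by clear -h1 uY; lia.
have sqZ := sqr_mod3_1 h5.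
case: hb' => hb'; case: h6 => h6.
- rewrite (_ : _ + b ^ 2 = X ^ 2 + b ^ 2 + Y ^ 2 + Z ^ 2); last by ring.
  apply: type_I_ndiv; split; split=> //; clear -h1 h6 h5 h4; lia.
- rewrite (_ : _ + b ^ 2 = X ^ 2 + b ^ 2 + Y ^ 2 + Z ^ 2); last by ring.
  apply: equal_pair_suffices; rewrite ?divide5 //; first by rewrite -divide5.
    by rewrite -divide5; apply: sqr_sub_divide; left; rewrite divide5; clear -h1 hb'; lia.
  have X3 : X mod 3 <> 0 by clear -h4 h5 h6; lia.
  left; move: (sqr_mod3_1 X3) sq0 sqZ; clear; move: (X ^ 2) (b ^ 2) (Z ^ 2) => u v w; lia.
- rewrite (_ : _ + b ^ 2 = Y ^ 2 + b ^ 2 + X ^ 2 + Z ^ 2); last by ring.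
  apply: equal_pair_suffices; rewrite ?divide5 //; first by rewrite -divide5.
    by rewrite -divide5; apply: sqr_sub_divide; right; rewrite divide5; clear -h1 hb'; lia.
  have Y3 : Y mod 3 <> 0 by clear -h4 h5 h6; lia.
  left; move: (sqr_mod3_1 Y3) sq0 sqZ; clear; move: (Y ^ 2) (b ^ 2) (Z ^ 2) => u v w; lia.
- rewrite (_ : _ + b ^ 2 = (- Y) ^ 2 + b ^ 2 + X ^ 2 + Z ^ 2); last by ring.
  apply: type_I_ndiv; split; split=> //; clear -h1 h6 h5 h4 hb'; lia.
Qed.

(** Reflections of [(a, c, d)] and [(a, - c, d)] both create a new equal pair with [b] modulo 5. If
    neither gives the right pattern modulo 3, then [a + c + d = 0] and [d - 2 a + 2 c = 0] modulo 9,
    whose difference is the second alternative. *)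
Lemma zero_mod3_move a b c d : c mod 5 <> 0 -> (a - 2 * c) mod 5 = 0 -> (b - 2 * c) mod 5 = 0 ->
  d mod 5 = 0 -> c mod 3 = 0 -> (a + d) mod 3 = 0 ->
  (a ^ 2 + b ^ 2 + c ^ 2 + d ^ 2) mod 3 = 0 ->
  four_squares_ndiv 5 (a ^ 2 + b ^ 2 + c ^ 2 + d ^ 2) \/ (c - 3 * a) mod 9 = 0.
Proof.
move=> uc ha hb hd c3 ad3 hn.
have ub : b mod 5 <> 0 by clear -uc hb; lia.
have [t ht] : exists t, a + c + d = 3 * t by exists ((a + c + d) / 3); clear -c3 ad3; lia.
have [s hs] : exists s, a + - c + d = 3 * s by exists ((a + - c + d) / 3); clear -c3 ad3; lia.
have pat x y z w : x ^ 2 + y ^ 2 + z ^ 2 + w ^ 2 = a ^ 2 + b ^ 2 + c ^ 2 + d ^ 2 ->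
    z mod 3 <> 0 -> pattern3 x y w.
  move=> e /sqr_mod3_1 hz; left; move: hn; rewrite -e; move: hz; clear.
  by move: (x ^ 2) (y ^ 2) (z ^ 2) (w ^ 2) => u v r q; lia.
have [t3|t3] := Z.eq_dec (t mod 3) 0; last first.
  have e : b ^ 2 + (d - 2 * t) ^ 2 + (c - 2 * t) ^ 2 + (a - 2 * t) ^ 2
      = a ^ 2 + b ^ 2 + c ^ 2 + d ^ 2.
    transitivity (b ^ 2 + ((a - 2 * t) ^ 2 + (c - 2 * t) ^ 2 + (d - 2 * t) ^ 2)); first by ring.
    by rewrite (reflect3 ht); ring.
  left; rewrite -e; apply: equal_pair_suffices; rewrite ?divide5 //.
  - clear -uc ha hd ht; lia.
  - clear -uc ha hd ht; lia.
  - clear -uc ha hd ht; lia.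
  - rewrite -divide5; apply: sqr_sub_divide; right; rewrite divide5; clear -ha hb hd ht; lia.
  - by apply: pat e _; clear -c3 t3; lia.
have [d3|d3] := Z.eq_dec ((d - 2 * s) mod 3) 0; last first.
  have e : b ^ 2 + (a - 2 * s) ^ 2 + (d - 2 * s) ^ 2 + (- c - 2 * s) ^ 2
      = a ^ 2 + b ^ 2 + c ^ 2 + d ^ 2.
    transitivity (b ^ 2 + ((a - 2 * s) ^ 2 + (- c - 2 * s) ^ 2 + (d - 2 * s) ^ 2)); first by ring.
    by rewrite (reflect3 hs); ring.
  left; rewrite -e; apply: equal_pair_suffices; rewrite ?divide5 //.
  - clear -uc ha hd hs; lia.
  - clear -uc ha hd hs; lia.
  - clear -uc ha hd hs; lia.
  - rewrite -divide5; apply: sqr_sub_divide; right; rewrite divide5; clear -ha hb hd hs; lia.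
  - by apply: pat e _; exact: d3.
right; clear -t3 d3 ht hs c3; lia.
Qed.

(** Outside [pattern3 a b d] three residue types modulo 3 remain. If 3 divides only [c], either
    [a = b] modulo 3 and [(a, b, d)] is reflected directly, or [zero_mod3_move] is used for both
    orders of [a] and [b]: two failures would give [3 a = c = 3 b] modulo 9. The other types are
    type I and, up to signs, the situation of [type_II_ndiv]. *)
Lemma odd_square_suffices a b c d : c mod 5 <> 0 -> (a - 2 * c) mod 5 = 0 ->
  (b - 2 * c) mod 5 = 0 -> d mod 5 = 0 -> d <> 0 ->
  (a ^ 2 + b ^ 2 + c ^ 2 + d ^ 2) mod 3 <> 1 -> four_squares_ndiv 5 (a ^ 2 + b ^ 2 + c ^ 2 + d ^ 2).
Proof.
move=> uc ha hb hd d0 hn.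
have ua : a mod 5 <> 0 by clear -uc ha; lia.
have ub : b mod 5 <> 0 by clear -uc hb; lia.
have hab : (5 | a ^ 2 - b ^ 2).
  by apply: sqr_sub_divide; left; rewrite divide5; clear -ha hb; lia.
have [hp|hp] := classic (pattern3 a b d).
  by apply: equal_pair_suffices; rewrite ?divide5 // -divide5.
have cases : [\/ [/\ c mod 3 = 0, a mod 3 <> 0, b mod 3 <> 0 & d mod 3 <> 0],
    [/\ c mod 3 <> 0, a mod 3 = 0, b mod 3 = 0 & d mod 3 <> 0] |
    [/\ c mod 3 <> 0, d mod 3 = 0 & (a mod 3 <> 0 /\ b mod 3 = 0) \/ (b mod 3 <> 0 /\ a mod 3 = 0)]].
  move: (sqr_mod3 a) (sqr_mod3 b) (sqr_mod3 c) (sqr_mod3 d) hn hp; rewrite /pattern3; clear.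
  move: (a ^ 2) (b ^ 2) (c ^ 2) (d ^ 2) => u v w t.
  move=> [][ha ?] [][hb ?] [][hc ?] [][hd ?] hn hp; rewrite !(ha, hb, hc, hd);
    try (by constructor 1); try (by constructor 2);
    try (by constructor 3; split=> //; left); try (by constructor 3; split=> //; right);
    exfalso; (try by clear -hn; lia); apply: hp; (try by right); left; lia.
case: cases => [[c3 a3 b3 d3]|[c3 a3 b3 d3]|[c3 d3 h]].
- have hn0 : (a ^ 2 + b ^ 2 + c ^ 2 + d ^ 2) mod 3 = 0.
    move: (sqr_mod3_1 a3) (sqr_mod3_1 b3) (sqr_mod3_0 c3) (sqr_mod3_1 d3); clear.
    by move: (a ^ 2) (b ^ 2) (c ^ 2) (d ^ 2) => u v w t; lia.
  have [ab3|ab3] := Z.eq_dec ((a - b) mod 3) 0.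
    wlog abd3 : d hd d3 {d0 hn hn0 hp} / (a + b + d) mod 3 = 0.
      move=> W; have [h|h] : (a + b + d) mod 3 = 0 \/ (a + b + - d) mod 3 = 0.
        by clear -a3 d3 ab3; lia.
        exact: W.
      rewrite (_ : d ^ 2 = (- d) ^ 2); last by ring.
      by apply: W => //; clear -hd d3; lia.
    rewrite (_ : _ + d ^ 2 = (a ^ 2 + b ^ 2 + d ^ 2) + c ^ 2); last by ring.
    apply: three_units_add_sqr; last by right; rewrite divide5.
    by apply: two_units_reflect => //; rewrite ?divide5 //; [exact: prime_5|..];
      clear -ha hb uc; lia.
  have move1 x y : (x - 2 * c) mod 5 = 0 -> (y - 2 * c) mod 5 = 0 -> x mod 3 <> 0 ->
      x ^ 2 + y ^ 2 = a ^ 2 + b ^ 2 ->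
      four_squares_ndiv 5 (a ^ 2 + b ^ 2 + c ^ 2 + d ^ 2) \/ (c - 3 * x) mod 9 = 0.
    move=> hx hy x3 e; rewrite -e in hn0 *.
    have [h|h] : (x + d) mod 3 = 0 \/ (x + - d) mod 3 = 0 by clear -x3 d3; lia.
      exact: zero_mod3_move.
    rewrite (_ : d ^ 2 = (- d) ^ 2) in hn0 *; last by ring.
    by apply: zero_mod3_move => //; clear -hd; lia.
  have [//|h1] := move1 a b ha hb a3 erefl.
  have [//|h2] := move1 b a hb ha b3 (Z.add_comm _ _).
  exfalso; clear -h1 h2 ab3; lia.
- have [h|h] : (c + d) mod 3 = 0 \/ (c + - d) mod 3 = 0 by clear -c3 d3; lia.
    exact: type_I_ndiv.
  rewrite (_ : d ^ 2 = (- d) ^ 2); last by ring.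
  by apply: type_I_ndiv; split; split=> //; clear -hd; lia.
- have side x y : (x - 2 * c) mod 5 = 0 -> (y - 2 * c) mod 5 = 0 -> x mod 3 <> 0 ->
      y mod 3 = 0 -> four_squares_ndiv 5 (x ^ 2 + y ^ 2 + c ^ 2 + d ^ 2).
    move=> hx hy x3 y3.
    have [h'|h'] : (x + c) mod 3 = 0 \/ (c + - x) mod 3 = 0 by clear -x3 c3; lia.
      rewrite (_ : _ + d ^ 2 = x ^ 2 + c ^ 2 + d ^ 2 + y ^ 2); last by ring.
      by apply: type_II_ndiv; rewrite ?divide5 //; left; left.
    rewrite (_ : _ + d ^ 2 = c ^ 2 + (- x) ^ 2 + d ^ 2 + y ^ 2); last by ring.
    apply: type_II_ndiv; rewrite ?divide5 //.
    + clear -hx uc; lia.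
    + clear -hx; lia.
    + by right; right; clear -hx hy; lia.
  case: h => [] [h1 h2]; first exact: side.
  by rewrite (Z.add_comm (a ^ 2)); apply: side.
Qed.

(** Unit squares modulo 5 are 1 or -1, so two of the three agree. If the third differs, then
    [x ^ 2 = - z ^ 2 = (2 z) ^ 2], and suitable signs give the vector [z (2, 2, 1, 0)]. *)
Lemma three_units_suffice_5 : three_units_suffice 5.
Proof.
move=> a b c d ua ub uc pd d0 hn _.
have pair x y z : ~ (5 | x) -> ~ (5 | y) -> ~ (5 | z) -> (5 | x ^ 2 - y ^ 2) ->
    ~ (5 | x ^ 2 - z ^ 2) -> (x ^ 2 + y ^ 2 + z ^ 2 + d ^ 2) mod 3 <> 1 ->
    four_squares_ndiv 5 (x ^ 2 + y ^ 2 + z ^ 2 + d ^ 2).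
  rewrite !divide5 => ux uy uz hxy hxz h.
  have opp w : (- w) ^ 2 = w ^ 2 by ring.
  have signed w : w mod 5 <> 0 -> (5 | w ^ 2 - x ^ 2) ->
      exists w', w' ^ 2 = w ^ 2 /\ (w' - 2 * z) mod 5 = 0.
    rewrite divide5 => uw hw.
    have [e|e] : (w - 2 * z) mod 5 = 0 \/ (- w - 2 * z) mod 5 = 0.
      move: (sqr_mod5 x) (sqr_mod5 z) (sqr_mod5 w) hw hxz ux uz uw; clear.
      move: (x ^ 2) (z ^ 2) (w ^ 2) => u v t.
      by move=> [][hx ?] [][hz ?] [][hw' ?] hw hxz ux uz uw; lia.
    - by exists w.
    - by exists (- w).
  have [x' [ex hx']] := signed x ux ltac:(by rewrite Z.sub_diag; apply: Z.divide_0_r).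
  have [|y' [ey hy']] := signed y uy.
    by rewrite divide5; clear -hxy; move: (x ^ 2) (y ^ 2) hxy => u v; lia.
  rewrite -ex -ey in h *; apply: odd_square_suffices => //; exact/divide5.
have [hab|hab] := classic (5 | a ^ 2 - b ^ 2).
  have [hac|hac] := classic (5 | a ^ 2 - c ^ 2); last exact: pair.
  have hbc : (5 | b ^ 2 - c ^ 2) by apply: (divide_comb (i := -1) (j := 1) hab hac); ring.
  rewrite (_ : _ + d ^ 2 = d ^ 2 + a ^ 2 + b ^ 2 + c ^ 2) in hn *; last by ring.
  case: (pattern3_exists hn) => /pattern3_rot hp.
  - rewrite (_ : _ + c ^ 2 = a ^ 2 + b ^ 2 + c ^ 2 + d ^ 2); last by ring.
    exact: equal_pair_suffices.
  - rewrite (_ : _ + c ^ 2 = a ^ 2 + c ^ 2 + b ^ 2 + d ^ 2); last by ring.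
    exact: equal_pair_suffices.
  - rewrite (_ : _ + c ^ 2 = b ^ 2 + c ^ 2 + a ^ 2 + d ^ 2); last by ring.
    exact: equal_pair_suffices.
have sym x y : ~ (5 | x ^ 2 - y ^ 2) -> ~ (5 | y ^ 2 - x ^ 2).
  by move=> h1 h2; apply: h1; apply: (divide_comb (i := -1) (j := 0) h2 h2); ring.
have [hac|hac] := classic (5 | a ^ 2 - c ^ 2).
  rewrite (_ : _ + d ^ 2 = a ^ 2 + c ^ 2 + b ^ 2 + d ^ 2) in hn *; last by ring.
  exact: pair.
have hbc : (5 | b ^ 2 - c ^ 2).
  move: ua ub uc hab hac; rewrite !divide5.
  move: (sqr_mod5 a) (sqr_mod5 b) (sqr_mod5 c); clear; move: (a ^ 2) (b ^ 2) (c ^ 2) => u v w.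
  by move=> [][? ?] [][? ?] [][? ?] ? ? ? ? ?; lia.
rewrite (_ : _ + d ^ 2 = b ^ 2 + c ^ 2 + a ^ 2 + d ^ 2) in hn *; last by ring.
by apply: pair => //; apply: sym.
Qed.

(** * Lagrange's four-square theorem *)

Local Close Scope Z_scope.
Import GRing.Theory.

(** Pigeonhole: for [0 <= i, j <= p./2] the values [i ^ 2] and [-1 - j ^ 2] form two sets of
    [(p + 1) / 2] residues each, which must meet. *)
Lemma sum_two_squares_Fp p : prime p -> odd p ->
  exists i j : nat, [/\ i <= p./2, j <= p./2 & p %| i ^ 2 + j ^ 2 + 1]%N.
Proof.
move=> pp op; pose h := p./2.
have ep : p = (h + h).+1 by rewrite addnn -[p in LHS]odd_double_half op.
have p1 := prime_gt1 pp.
pose f (i : 'I_h.+1) : 'F_p := ((i : nat)%:R ^+ 2)%R.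
have char0 k : ((k%:R : 'F_p) == 0)%R = (p %| k)%N.
  by rewrite -(dvdn_pcharf (pchar_Fp pp)).
have f_inj : injective f.
  have half (i j : 'I_h.+1) : (i <= j)%N -> f i = f j -> i = j.
    move=> ij /esym/eqP; rewrite /f -subr_eq0 subr_sqr mulf_eq0 -natrB // -natrD !char0.
    have lj := ltn_ord j; have li := ltn_ord i.
    case/orP=> /dvdn_leq h'; apply/val_inj => /=.
    - apply/eqP; rewrite eqn_leq ij -subn_eq0; apply: contraT; rewrite -lt0n => /h'.
      rewrite leqNgt ep ltnS (leq_trans (leq_subr _ _)) //.
      by rewrite (leq_trans (ltnSE lj)) // leq_addr.
    - have : (j + i = 0)%N.
        apply/eqP; apply: contraT; rewrite -lt0n => /h'.
        by rewrite leqNgt ep ltnS leq_add.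
      by move/eqP; rewrite addn_eq0 => /andP[/eqP -> /eqP ->].
  move=> i j; case: (leqP i j) => [|/ltnW] le e; first exact: half.
  by apply/esym/half.
pose g i := (- 1 - f i)%R.
have g_inj : injective g by move=> i j /addrI/oppr_inj/f_inj.
have [v] : exists v, (v \in f @: setT) && (v \in g @: setT).
  apply/existsP; apply: contraT => /existsPn disj.
  have dis : [disjoint f @: setT & g @: setT].
    by apply/pred0P => v /=; apply/negbTE/disj.
  have := max_card (mem (f @: setT :|: g @: setT)).
  rewrite cardsU (disjoint_setI0 dis) cards0 subn0 !card_imset // cardsT card_ord card_Fp //.
  by rewrite ep addSn addnS ltnn.
case/andP=> /imsetP[i _ ->] /imsetP[j _ e]; exists i, j.
split; try exact: ltnSE (ltn_ord _).
by rewrite -char0 !natrD !natrX -/(f i) -/(f j) e /g subrK addNr.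
Qed.

Local Open Scope Z_scope.

Definition sum4 (n : Z) : Prop := exists a b c d, n = a ^ 2 + b ^ 2 + c ^ 2 + d ^ 2.

Lemma euler_four_squares x1 x2 x3 x4 y1 y2 y3 y4 :
  (x1 ^ 2 + x2 ^ 2 + x3 ^ 2 + x4 ^ 2) * (y1 ^ 2 + y2 ^ 2 + y3 ^ 2 + y4 ^ 2) =
  (x1 * y1 + x2 * y2 + x3 * y3 + x4 * y4) ^ 2 + (x1 * y2 - x2 * y1 + x3 * y4 - x4 * y3) ^ 2
  + (x1 * y3 - x3 * y1 + x4 * y2 - x2 * y4) ^ 2 + (x1 * y4 - x4 * y1 + x2 * y3 - x3 * y2) ^ 2.
Proof. ring. Qed.

Lemma sum4_mul m n : sum4 m -> sum4 n -> sum4 (m * n).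
Proof.
move=> [x1 [x2 [x3 [x4 ->]]]] [y1 [y2 [y3 [y4 ->]]]].
by rewrite euler_four_squares; do 4!eexists.
Qed.

Lemma centred_residue m x : 0 < m -> exists y q, x = y + m * q /\ - m <= 2 * y <= m.
Proof.
move=> m0; have e := Z.div_mod x m; have b := Z.mod_pos_bound x m m0.
have [h|h] := Z.le_gt_cases (2 * (x mod m)) m.
  by exists (x mod m), (x / m); split; [clear h b; lia|clear e; lia].
by exists (x mod m - m), (x / m + 1); split; [clear h b; lia|clear e; lia].
Qed.

(** Reducing the [x] modulo [m] to centred residues [y] gives [m r] as a sum of four squares with
    [0 <= r <= m]. Both [r = 0] and [r = m] force [m] to divide [p]; otherwise the Euler product of
    the two sums, divided by [m ^ 2], represents [r p]. *)
Lemma sum4_descent p m : Znumtheory.prime p -> 0 < m < p -> sum4 (m * p) -> sum4 p.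
Proof.
move=> pp; have [k] : exists k : nat, (m < Z.of_nat k) by exists (Z.to_nat m).+1; lia.
elim: k m => [|k IH] m hk hm; first by exfalso; lia.
have [->|m1] := Z.eq_dec m 1; first by rewrite Z.mul_1_l.
have no_div : ~ (m | p).
  move=> h; have [|[|[|]]] := prime_divisors p pp m h; clear -hm m1; lia.
move=> [x1 [x2 [x3 [x4 e]]]].
have m0 : 0 < m by clear -hm; lia.
have [y1 [q1 [e1 b1]]] := centred_residue x1 m0; have [y2 [q2 [e2 b2]]] := centred_residue x2 m0.
have [y3 [q3 [e3 b3]]] := centred_residue x3 m0; have [y4 [q4 [e4 b4]]] := centred_residue x4 m0.
pose r := p - 2 * (q1 * y1 + q2 * y2 + q3 * y3 + q4 * y4)
  - m * (q1 ^ 2 + q2 ^ 2 + q3 ^ 2 + q4 ^ 2).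
have er : y1 ^ 2 + y2 ^ 2 + y3 ^ 2 + y4 ^ 2 = m * r.
  by rewrite /r !Z.mul_sub_distr_l e e1 e2 e3 e4; ring.
have sq y : - m <= 2 * y <= m -> 0 <= (m - 2 * y) * (m + 2 * y).
  by clear; move=> h; apply: Z.mul_nonneg_nonneg; lia.
have s1 := sq _ b1; have s2 := sq _ b2; have s3 := sq _ b3; have s4 := sq _ b4.
have es : (m - 2 * y1) * (m + 2 * y1) + (m - 2 * y2) * (m + 2 * y2)
  + (m - 2 * y3) * (m + 2 * y3) + (m - 2 * y4) * (m + 2 * y4) = 4 * (m * (m - r)).
  by rewrite Z.mul_sub_distr_l -er; ring.
have r_le : 0 <= m - r.
  by apply/(Z.mul_le_mono_pos_l _ _ m m0); clear -s1 s2 s3 s4 es; lia.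
have r_ge : 0 <= r.
  apply/(Z.mul_le_mono_pos_l _ _ m m0); rewrite Z.mul_0_r -er.
  by repeat (apply: Z.add_nonneg_nonneg); (rewrite Z.pow_2_r; exact: Z.square_nonneg).
have [r0|r0] := Z.eq_dec r 0.
  have z : [/\ y1 = 0, y2 = 0, y3 = 0 & y4 = 0].
    move: er; rewrite r0 Z.mul_0_r; clear => er.
    have pos y : 0 <= y * y by exact: Z.square_nonneg.
    move: (pos y1) (pos y2) (pos y3) (pos y4) er; rewrite !Z.pow_2_r => p1 p2 p3 p4 er.
    have sq0 y : y * y = 0 -> y = 0 by case/Z.mul_eq_0.
    by split; apply: sq0; clear -p1 p2 p3 p4 er; lia.
  case: z => z1 z2 z3 z4; case: no_div.
  exists (q1 ^ 2 + q2 ^ 2 + q3 ^ 2 + q4 ^ 2).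
  transitivity (r + m * (q1 ^ 2 + q2 ^ 2 + q3 ^ 2 + q4 ^ 2)); last by rewrite r0; ring.
  by rewrite /r z1 z2 z3 z4; ring.
have [rm|rm] := Z.eq_dec r m.
  have ext y : (m - 2 * y) * (m + 2 * y) = 0 -> exists t, 2 * y = t * m.
    by clear; case/Z.mul_eq_0 => h; [exists 1|exists (-1)]; lia.
  rewrite rm Z.sub_diag Z.mul_0_r in es.
  have [t1 h1] : exists t, 2 * y1 = t * m by apply: ext; clear -s1 s2 s3 s4 es; lia.
  have [t2 h2] : exists t, 2 * y2 = t * m by apply: ext; clear -s1 s2 s3 s4 es; lia.
  have [t3 h3] : exists t, 2 * y3 = t * m by apply: ext; clear -s1 s2 s3 s4 es; lia.
  have [t4 h4] : exists t, 2 * y4 = t * m by apply: ext; clear -s1 s2 s3 s4 es; lia.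
  case: no_div; exists (1 + q1 * t1 + q2 * t2 + q3 * t3 + q4 * t4
    + q1 ^ 2 + q2 ^ 2 + q3 ^ 2 + q4 ^ 2).
  transitivity (r + q1 * (2 * y1) + q2 * (2 * y2) + q3 * (2 * y3) + q4 * (2 * y4)
    + m * (q1 ^ 2 + q2 ^ 2 + q3 ^ 2 + q4 ^ 2)); first by rewrite /r; ring.
  by rewrite h1 h2 h3 h4 rm; ring.
apply: (IH r); [clear -rm r_le hk; lia|clear -r0 r_ge r_le hm; lia|].
(* These are the four terms of the Euler identity divided by [m], after substituting
   [x = y + m q]. *)
exists (r + q1 * y1 + q2 * y2 + q3 * y3 + q4 * y4), (q1 * y2 - q2 * y1 + q3 * y4 - q4 * y3),
  (q1 * y3 - q3 * y1 + q4 * y2 - q2 * y4), (q1 * y4 - q4 * y1 + q2 * y3 - q3 * y2).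
apply: (Z.mul_reg_l _ _ (m ^ 2)); first by clear -m0; nia.
transitivity ((m * p) * (m * r)); first by ring.
rewrite e -er euler_four_squares e1 e2 e3 e4.
transitivity ((m * r + m * (q1 * y1 + q2 * y2 + q3 * y3 + q4 * y4)) ^ 2 + 
  m ^ 2 * ((q1 * y2 - q2 * y1 + q3 * y4 - q4 * y3) ^ 2 + 
  (q1 * y3 - q3 * y1 + q4 * y2 - q2 * y4) ^ 2 + (q1 * y4 - q4 * y1 + q2 * y3 - q3 * y2) ^ 2));
  last by ring.
by rewrite -er; ring.
Qed.

Lemma divide_of_nat (p n : nat) : (Z.of_nat p | Z.of_nat n) <-> (p %| n)%N.
Proof.
split=> [[q hq]|/dvdnP[q ->]]; last by exists (Z.of_nat q); rewrite -Nat2Z.inj_mul.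
have [n0|n0] := posnP n; first by rewrite n0 dvdn0.
apply/dvdnP; exists (Z.to_nat q); apply: Nat2Z.inj; rewrite -multE Nat2Z.inj_mul Z2Nat.id //.
by move/ltP: n0; clear -hq; nia.
Qed.

Lemma prime_of_nat p : prime p -> Znumtheory.prime (Z.of_nat p).
Proof.
move=> pp; have /ltP p1 := prime_gt1 pp; apply/prime_alt; split; first by lia.
move=> n hn h; rewrite -(Z2Nat.id n) in h; last by lia.
have n1 : Z.to_nat n != 1%N by apply/eqP; lia.
by move/divide_of_nat/(prime_nt_dvdP pp n1): h; lia.
Qed.

Lemma sum4_prime p : prime p -> sum4 (Z.of_nat p).
Proof.
move=> pp; have [->|op] := even_prime pp; first by exists 1, 1, 0, 0.
have [i [j [hi hj /dvdnP[m hm]]]] := sum_two_squares_Fp pp op.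
have hp : Z.of_nat p = 2 * Z.of_nat p./2 + 1.
  by rewrite -[in LHS](odd_double_half p) op -addnn add1n -plusE; lia.
have e : Z.of_nat m * Z.of_nat p = Z.of_nat i ^ 2 + Z.of_nat j ^ 2 + 1 ^ 2 + 0 ^ 2.
  by rewrite -Nat2Z.inj_mul multE -hm -!mulnn -!plusE -!multE; lia.
(* With [p = 2 h + 1] one has [m p <= 2 h ^ 2 + 1 < p ^ 2], so [m < p]. *)
apply: (@sum4_descent _ (Z.of_nat m)); first exact: prime_of_nat.
  move/ltP/Nat2Z.inj_lt: (prime_gt1 pp).
  move/leP/Nat2Z.inj_le: hi hp e; move/leP/Nat2Z.inj_le: hj.
  move: (Nat2Z.is_nonneg i) (Nat2Z.is_nonneg j) (Nat2Z.is_nonneg m).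
  move: (Z.of_nat i) (Z.of_nat j) (Z.of_nat m) (Z.of_nat p) (Z.of_nat p./2); clear.
  move=> x y u v h x0 y0 u0 yh xh -> e h1.
  have xx : x * x <= h * h by apply: Z.mul_le_mono_nonneg.
  have yy : y * y <= h * h by apply: Z.mul_le_mono_nonneg.
  have x2 := Z.square_nonneg x; have y2 := Z.square_nonneg y.
  rewrite !Z.pow_2_r in e; split.
    have [u1|//] : u = 0 \/ 0 < u by lia.
    by rewrite u1 in e; lia.
  have [//|uh] := Z.lt_ge_cases u (2 * h + 1).
  have : (2 * h + 1) * (2 * h + 1) <= u * (2 * h + 1) by apply: Z.mul_le_mono_nonneg_r; lia.
  by have := Z.square_nonneg h; lia.
by rewrite e; do 4!eexists.
Qed.

Lemma sum4_nat n : sum4 (Z.of_nat n).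
Proof.
elim/ltn_ind: n => n IH; have [n1|n1] := ltnP 1 n; last first.
  by case: n n1 {IH} => [|[|]] // _; [exists 0, 0, 0, 0|exists 1, 0, 0, 0].
have pp := pdiv_prime n1; have := pdiv_dvd n => /dvdnP[m e].
rewrite e Nat2Z.inj_mul; apply: sum4_mul; last exact: sum4_prime.
apply: IH; rewrite e ltn_Pmulr ?prime_gt1 //.
by case: m e => // e; rewrite e in n1.
Qed.

(** * Transfer to sums of at most four squares prime to p *)

Lemma four_squares_ndiv_nat p n : prime p -> (3 < p)%N -> ~~ (p %| n)%N -> (n %% 3 != 1)%N ->
  four_squares_ndiv (Z.of_nat p) (Z.of_nat n).
Proof.
move=> pp p3 pn n3; have zp := prime_of_nat pp; have zp3 : 3 < Z.of_nat p by move/ltP: p3; lia.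
have [a [b [c [d e]]]] := sum4_nat n.
apply: (four_squares_ndiv_of_three_units zp zp3 _ e).
- have [/(prime_gt3_divide5 zp zp3) ->|] := classic (Z.of_nat p | 5).
    exact: three_units_suffice_5.
  exact: three_units_suffice_not5.
- move=> h; case/negP: n3; apply/eqP.
  have /ltP r3 : (n %% 3 < 3)%N by rewrite ltn_mod.
  have : Z.of_nat n = Z.of_nat (n %/ 3) * 3 + Z.of_nat (n %% 3).
    by rewrite {1}(divn_eq n 3) -plusE -multE Nat2Z.inj_add Nat2Z.inj_mul.
  by move: (n %/ 3)%N (n %% 3)%N r3 h => q r; clear; lia.
- by move/divide_of_nat; apply/negP.
Qed.

Lemma coprime_abs_nat p x : prime p -> x = 0 \/ ~ (Z.of_nat p | x) ->
  (Z.abs_nat x != 0%N) ==> coprime p (Z.abs_nat x).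
Proof.
move=> pp [->//|ux]; apply/implyP => _; rewrite prime_coprime //; apply/negP.
by move/divide_of_nat; rewrite Zabs2Nat.id_abs => /Z.divide_abs_r.
Qed.

Local Close Scope Z_scope.
Import Order.TTheory GRing.Theory Num.Theory.
Local Open Scope ring_scope.

Lemma sum_of_squares_seq (p : nat) (s : seq nat) :
  all (coprime p) s -> sum_of_squares_ndiv p (size s) (\sum_(y <- s) y ^ 2)%N.
Proof.
move/(all_nthP 0%N)=> cop; exists (fun i : 'I_(size s) => (nth 0%N s i)%:Z); split.
  rewrite (big_nth 0%N) big_mkord (big_morph Posz PoszD (erefl 0)).
  by apply: eq_bigr => i _; rewrite -mulnn PoszM expr2.
elim/big_ind: _ => [|x y hx hy|i _]; last by rewrite coprimezE cop.
  by rewrite coprimezE coprimen1.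
by rewrite coprimezMr hx.
Qed.

(** The zero terms are filtered out; at least one term survives because [n] is positive. *)
Lemma sum_of_squares_ndiv_of_four (p n : nat) : prime p -> (0 < n)%N ->
  four_squares_ndiv (Z.of_nat p) (Z.of_nat n) ->
  exists k : nat, (0 < k <= 4)%N /\ sum_of_squares_ndiv p k n%:Z.
Proof.
move=> pp n_gt0 [a [b [c [d [e ha hb hc hd]]]]].
pose s0 := [seq Z.abs_nat x | x <- [:: a; b; c; d]].
pose s := [seq y <- s0 | y != 0%N].
have es : n = (\sum_(y <- s) y ^ 2)%N.
  rewrite big_filter big_mkcond (eq_bigr (fun y => y ^ 2)%N); last by move=> [|y].
  rewrite /s0 /= !big_cons big_nil addn0 -!mulnn -!plusE -!multE.
  apply: Nat2Z.inj; rewrite e !Nat2Z.inj_add !Nat2Z.inj_mul !Zabs2Nat.id_abs.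
  by rewrite !Z.abs_square; ring.
exists (size s); split.
  rewrite size_filter (leq_trans (count_size _ _)) // andbT -size_filter -/s.
  by case: (s) es n_gt0 => // ->; rewrite big_nil.
rewrite es; apply: sum_of_squares_seq; rewrite all_filter /s0.
by rewrite /= !coprime_abs_nat.
Qed.

Theorem theorem4p2 (p : nat) (n : int) (p_prime : prime p) (p_gt3 : (3 < p)%N)
    (n_gt0 : 0 < n) (p_ndvd_n : ~~ (p%:Z %| n)%Z)
    (n_mod3 : (n = 0 %[mod 3])%Z \/ (n = 2 %[mod 3])%Z) :
  exists k : nat, (0 < k <= 4)%N /\ sum_of_squares_ndiv p k n.
Proof.
case: n n_gt0 p_ndvd_n n_mod3 => // n n_gt0 p_ndvd_n n_mod3.
apply: sum_of_squares_ndiv_of_four => //; apply: four_squares_ndiv_nat => //.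
by case: n_mod3 => [] /eqP; rewrite !modz_nat eqz_nat => /eqP ->.
Qed.
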